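(* Let $\alpha\in[0,1)$ and $\epsilon\in(0,\min\{1/2,1/(10(1-\alpha))\})$. Let $\beta=\frac{\epsilon/4}{(1+\alpha)\log(4mn\rho/\epsilon)}$, $\beta'=\frac{(1-\alpha)\epsilon/4}{\log(n\rho/(1-\epsilon))}$, $h=\frac{(1-\alpha)\beta\beta'}{16\epsilon(1+\beta)}$, and $K=\lceil\frac{2}{h(1-\alpha)\epsilon}\rceil$. Define $\mathbf{x}^{(0)}=\big(\frac{1-\epsilon}{n\rho}\big)^{1-\alpha}\mathbb{1}$, $\mathbf{z}^{(0)}=(\mathbf{x}^{(0)})^{-\beta'}-\mathbb{1}$, and for $k\ge1$: $\mathbf{x}^{(k)}=(\mathbb{1}+\mathbf{z}^{(k-1)})^{-1/\beta'}$, $\mathbf{z}^{(k)}=\mathbf{z}^{(k-1)}+\epsilon h\,\overline{\nabla f_r}(\mathbf{x}^{(k)})$. Then $K=\Theta\big(\frac{\log(n\rho)\log(mn\rho/\epsilon)}{(1-\alpha)^3\epsilon^2}\big)$, the vector $\mathbf{x}_\alpha=(\mathbf{x}^{(K+1)})^{1/(1-\alpha)}$ satisfies $A\mathbf{x}_\alpha\le\mathbb{1}$, $\mathbf{x}_\alpha\ge\mathbf{0}$, and $f_\alpha(\mathbf{x}_\alpha)-f_\alpha(\mathbf{x}^*_\alpha)\ge-3\epsilon(1-\alpha)f_\alpha(\mathbf{x}^*_\alpha)$.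
   Context: $A\in\mathbb{R}^{m\times n}$ is entrywise nonnegative with smallest nonzero entry $1$ and largest entry $\rho$; $\mathbb{1}$ is the all-ones vector; vector powers are coordinatewise; $\log$ is natural. $f_\alpha(\mathbf{x})=\sum_j x_j^{1-\alpha}/(1-\alpha)$, and $\mathbf{x}^*_\alpha$ is an optimal solution of the $\alpha$-fair packing problem $\max\{f_\alpha(\mathbf{x}):A\mathbf{x}\le\mathbb{1},\mathbf{x}\ge\mathbf{0}\}$. With $C=(1+\epsilon/2)^{1/\beta}$ and $F_\alpha(\mathbf{x})=\mathbf{x}^{1/(1-\alpha)}$, define on $\mathbb{R}^n_{\ge0}$: $f_r(\mathbf{x})=-\frac{\langle\mathbb{1},\mathbf{x}\rangle}{1-\alpha}+\frac{C\beta}{1+\beta}\sum_{i=1}^m(AF_\alpha(\mathbf{x}))_i^{(1+\beta)/\beta}$. The truncated gradient is $\overline{\nabla_j f_r}(\mathbf{x})=(1-\alpha)\nabla_j f_r(\mathbf{x})$ if this value lies in $[-1,1]$, and $\overline{\nabla_j f_r}(\mathbf{x})=1$ otherwise.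
   Formalization: The upper bound in K = Θ(...) is proved only for nρ ≥ r0, for each fixed r0 > 1, with a constant depending on r0, because at n = ρ = 1 the rate log(nρ)log(mnρ/ε)/((1-α)^3 ε^2) is 0 while K > 0; the lower bound and all other claims are unrestricted. *)

(* Defs.v *)
From HB Require Import structures.
From mathcomp Require Import all_boot all_order all_algebra.
From mathcomp Require Import all_classical all_reals all_analysis.

Set Implicit Arguments.
Unset Strict Implicit.
Unset Printing Implicit Defensive.

Import Order.TTheory GRing.Theory Num.Theory.
Import numFieldNormedType.Exports.

Local Open Scope ring_scope.

(* The existence clauses force 0 < m, 0 < n and 1 <= rho. *)
Definition normalized_mx (R : realType) (m n : nat) (A : 'M[R]_(m, n))
    (rho : R) : Prop :=
  [/\ forall i j, 0 <= A i j,
      (exists i j, A i j = 1) /\ (forall i j, A i j != 0 -> 1 <= A i j)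
    & (exists i j, A i j = rho) /\ (forall i j, A i j <= rho)].

Definition vpow (R : realType) (n : nat) (x : 'cV[R]_n) (p : R) : 'cV[R]_n :=
  \col_j (x j 0 `^ p).

Definition fair_utility (R : realType) (n : nat) (alpha : R) (x : 'cV[R]_n) : R :=
  \sum_j (x j 0 `^ (1 - alpha) / (1 - alpha)).

Definition packing_feasible (R : realType) (m n : nat) (A : 'M[R]_(m, n))
    (x : 'cV[R]_n) : Prop :=
  (forall i, (A *m x) i 0 <= 1) /\ (forall j, 0 <= x j 0).

Definition fair_packing_optimal (R : realType) (m n : nat) (A : 'M[R]_(m, n))
    (alpha : R) (xstar : 'cV[R]_n) : Prop :=
  packing_feasible A xstar /\
  forall x, packing_feasible A x ->
    fair_utility alpha x <= fair_utility alpha xstar.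

Section Constants.
Context {R : realType}.
Variables (m n : nat) (rho alpha eps : R).

Definition beta : R :=
  (eps / 4) / ((1 + alpha) * ln (4 * m%:R * n%:R * rho / eps)).

Definition beta' : R :=
  ((1 - alpha) * eps / 4) / ln (n%:R * rho / (1 - eps)).

Definition stepsize : R :=
  (1 - alpha) * beta * beta' / (16 * eps * (1 + beta)).

(* The argument of the ceiling is positive for the parameters of interest, so
   taking the absolute value of the integer only changes its type. *)
Definition num_iter : nat :=
  `|Num.ceil (2 / (stepsize * (1 - alpha) * eps))|%N.

Definition iter_rate : R :=
  ln (n%:R * rho) * ln (m%:R * n%:R * rho / eps)
    / ((1 - alpha) ^+ 3 * eps ^+ 2).

End Constants.

Section Algorithm.
Context {R : realType} {m n : nat}.
Variables (A : 'M[R]_(m, n)) (rho alpha eps : R).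
Local Notation b := (beta m n rho alpha eps).
Local Notation b' := (beta' n rho alpha eps).
Local Notation h := (stepsize m n rho alpha eps).

(* Only the values on the nonnegative orthant are meaningful; the partial
   derivatives below are taken at points with positive coordinates, where the
   extension to 'cV[R]_n is irrelevant. *)
Definition fr (x : 'cV[R]_n) : R :=
  - ((\sum_j x j 0) / (1 - alpha))
  + ((1 + eps / 2) `^ b^-1 * b / (1 + b))
    * \sum_i ((A *m vpow x (1 - alpha)^-1) i 0 `^ ((1 + b) / b)).

Definition trunc_grad (x : 'cV[R]_n) : 'cV[R]_n :=
  \col_j let g : R := (1 - alpha) * 'D_(delta_mx j 0) fr x in
         if -1 <= g <= 1 then g else 1.

Definition x_init : 'cV[R]_n :=
  const_mx (((1 - eps) / (n%:R * rho)) `^ (1 - alpha)).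

Definition mirror_point (z : 'cV[R]_n) : 'cV[R]_n :=
  vpow (const_mx 1 + z) (- b'^-1).

Fixpoint z_iter (k : nat) : 'cV[R]_n :=
  if k is k'.+1 then
    z_iter k' + (eps * h) *: trunc_grad (mirror_point (z_iter k'))
  else vpow x_init (- b') - const_mx 1.

Definition x_iter (k : nat) : 'cV[R]_n :=
  if k is k'.+1 then mirror_point (z_iter k') else x_init.

Definition x_output : 'cV[R]_n :=
  vpow (x_iter (num_iter m n rho alpha eps).+1) (1 - alpha)^-1.

End Algorithm.

(* Main.v *)
Require Import Defs.
From HB Require Import structures.
From mathcomp Require Import all_boot all_order all_algebra.
From mathcomp Require Import all_classical all_reals all_analysis.
From mathcomp Require Import ring lra.

Set Implicit Arguments.
Unset Strict Implicit.
Unset Printing Implicit Defensive.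

Import Order.TTheory GRing.Theory Num.Theory.
Import numFieldNormedType.Exports.

Local Open Scope ring_scope.

(* Substitute x_j = y_j^(1-alpha), so that the utility becomes linear and the
   constraint reads A F(x) <= 1; (1 - alpha) fr is then a convex penalized
   objective whose partial derivatives are price_j - 1.  The iteration is mirror
   descent for it, with dual variables 1 + z = x^(-beta').

   Each step multiplies x_j by a factor so close to 1 that, by Jensen's
   inequality applied to the loads (A F(x))_i, the objective decreases by a fixed
   fraction of its first-order decrease; this holds also where the gradient is
   truncated.  The decrease pays both for the second-order error of the mirror
   step and for the truncated part of the gradient, so summing the usual Bregman
   regret inequality over K steps bounds objective(x_K) - objective(u), where u
   comes from the optimum scaled by 1 - 3 eps / 4.  That scaling makes the
   penalty of u negligible, because ((1 + eps/2) load)^(1/beta) is tiny when the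
   load is at most 1 - 3 eps / 4; conversely it is huge for an almost tight row,
   which keeps all iterates feasible.  The regret bound needs a lower bound on
   log (n rho / (1 - eps)), hence n >= 2; for n = 1 the starting point is already
   good enough. *)

(** * Real powers and truncation *)

Section RealPowers.
Context {R : realType}.
Implicit Types a b r t u v x : R.

(** From e^(-t) >= 1 - t one gets e^t <= 1 / (1 - t); the constant 8/7 is 1 / (1 - 1/8). *)
Lemma expR_le_quadratic t : t <= 1 / 8 -> expR t <= 1 + t + 8 / 7 * t ^+ 2.
Proof.
move=> t8; have t1 : 0 < 1 - t by lra.
have : expR t * (1 - t) <= 1.
  rewrite -[leRHS](expRxMexpNx_1 t) ler_pM2l ?expR_gt0//.
  by have := expR_ge1Dx (- t); lra.
rewrite -ler_pdivlMr// => /le_trans; apply.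
rewrite ler_pdivrMr//; have := sqr_ge0 t; nra.
Qed.

Lemma powR_exp x r : 0 < x -> x `^ r = expR (r * ln x).
Proof. by move=> x0; rewrite /powR gt_eqF. Qed.

Lemma powR_gt1 x r : 0 < r -> 1 < x -> 1 < x `^ r.
Proof.
move=> r0 x1; rewrite powR_exp; last by lra.
by rewrite expR_gt1 mulr_gt0// ln_gt0.
Qed.

Lemma powR_lt1 x r : 0 < r -> 0 < x < 1 -> x `^ r < 1.
Proof.
move=> r0 x01; rewrite powR_exp; last by lra.
by rewrite expR_lt1 pmulr_rlt0// ln_lt0.
Qed.

Lemma le_powRN r x y : 0 <= r -> 0 < y -> y <= x -> x `^ (- r) <= y `^ (- r).
Proof.
move=> r0 y0 yx; have x0 : 0 < x by exact: lt_le_trans yx.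
rewrite !powRN lef_pV2 ?posrE ?powR_gt0//.
by rewrite ge0_ler_powR ?nnegrE// ltW.
Qed.

Lemma powRN_ge_linear v r : -1 < v -> 0 <= r -> 1 - r * v <= (1 + v) `^ (- r).
Proof.
move=> v1 r0; rewrite powR_exp; last by lra.
have /(ler_wpM2l r0) := le_ln1Dx v1.
by have := expR_ge1Dx (- r * ln (1 + v)); lra.
Qed.

Lemma ln_ge_sub1V x : 0 < x -> 1 - x^-1 <= ln x.
Proof.
move=> x0; have xV0 : 0 < x^-1 by rewrite invr_gt0.
have := @le_ln1Dx R (x^-1 - 1).
have -> : 1 + (x^-1 - 1) = x^-1 by ring.
by rewrite lnV ?posrE// => ?; lra.
Qed.

(** Combines ln (1 + v) >= v / (1 + v) >= v - 2 v^2 with the quadratic bound on the exponential. The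
    assumption 3 <= r makes r v^2 at most (r v)^2 / 3, so the error depends on r v only. *)
Lemma powRN_le_quadratic v r : 3 <= r -> `|r * v| <= 1 / 16 ->
  (1 + v) `^ (- r) <= 1 - r * v + 2 * (r * v) ^+ 2.
Proof.
move=> r3 rv; have r0 : 0 < r by lra.
have [rv1 rv2] : - (1 / 16) <= r * v /\ r * v <= 1 / 16.
  by move: rv; rewrite ler_norml => /andP.
have v1 : - (1 / 48) <= v by nra.
have v2 : v <= 1 / 48 by nra.
rewrite powR_exp; last by lra.
have lnv : v - 2 * v ^+ 2 <= ln (1 + v).
  apply: le_trans (ln_ge_sub1V _); last by lra.
  have -> : 1 - (1 + v)^-1 = v / (1 + v) by field; lra.
  rewrite ler_pdivlMr; last by lra.
  have := sqr_ge0 v; nra.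
set th := r * v in rv1 rv2 *.
have e1 : - r * ln (1 + v) <= - th + 2 / 3 * th ^+ 2.
  have : r * (v - 2 * v ^+ 2) <= r * ln (1 + v) by rewrite ler_pM2l.
  have : 0 <= (r - 3) * r * v ^+ 2.
    by apply: mulr_ge0; [nra|exact: sqr_ge0].
  rewrite /th; lra.
have tt : 0 <= th ^+ 2 <= 1 / 256 by rewrite sqr_ge0/=; nra.
rewrite -ler_expR in e1; apply: le_trans e1 _.
apply: le_trans (expR_le_quadratic _) _; first by lra.
have -> : (- th + 2 / 3 * th ^+ 2) ^+ 2 = th ^+ 2 * (1 - 2 / 3 * th) ^+ 2 by ring.
have : th ^+ 2 * (1 - 2 / 3 * th) ^+ 2 <= th ^+ 2 * (25 / 24) ^+ 2.
  by apply: ler_wpM2l; [lra | nra].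
lra.
Qed.

(** Convexity of the power function, from Young's inequality for a and b^(r-1) with the conjugate
    exponents r and r / (r - 1). *)
Lemma powR_ge_tangent a b r : 1 <= r -> 0 <= a -> 0 <= b ->
  b `^ r + r * b `^ (r - 1) * (a - b) <= a `^ r.
Proof.
rewrite le_eqVlt => /predU1P[<- a0 b0|r1 a0].
  by rewrite subrr powRr0 !powRr1//; lra.
rewrite le_eqVlt => /predU1P[<-|b0].
  rewrite !powR0; [|lra|lra].
  by rewrite mulr0 mul0r addr0 powR_ge0.
have r0 : r != 0 by lra.
have := @conjugate_powR R a (b `^ (r - 1)) r (r / (r - 1)) a0 (powR_ge0 _ _).
rewrite -powRrM (_ : (r - 1) * (r / (r - 1)) = r); last by field; lra.
have r2 : 0 < r / (r - 1) by rewrite divr_gt0; lra.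
move=> /(_ ltac:(lra) r2).
rewrite (_ : r^-1 + (r / (r - 1))^-1 = 1); last by field; lra.
move=> /(_ erefl).
have -> : (r / (r - 1))^-1 = 1 - r^-1 by field; lra.
have <- : b * b `^ (r - 1) = b `^ r by rewrite mulr_powRB1// ?ltW//; lra.
have rr : r * r^-1 = 1 by rewrite divff.
have := powR_ge0 a r.
set x := a `^ r; set y := b `^ _ => x0.
rewrite -(@ler_pM2l _ r); last by lra.
have -> : r * (x / r + b * y * (1 - r^-1)) = x + b * y * (r - 1) by field.
lra.
Qed.

(** The tangent at x of the concave power u^(1-b), obtained from the convex tangent with exponent 1
    / (1 - b) at the points u^(1-b) and x^(1-b). *)
Lemma powR1B_le b u x : 0 < b < 1 -> 0 <= u -> 0 < x ->
  u `^ (1 - b) <= (1 - b) * u * x `^ (- b) + b * x `^ (1 - b).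
Proof.
move=> b01 u0 x0; have b1 : 1 - b != 0 by lra.
have i1 : 1 <= (1 - b)^-1 by rewrite invf_ge1; lra.
have := powR_ge_tangent i1 (powR_ge0 u (1 - b)) (powR_ge0 x (1 - b)).
rewrite -!powRrM divff// !powRr1 ?(ltW x0)//.
rewrite (_ : (1 - b) * ((1 - b)^-1 - 1) = b); last by field.
rewrite [x `^ (1 - b)]powRD ?(gt_eqF x0) ?implybT// powRr1 ?(ltW x0)// powRN.
have xb : 0 < x `^ b by rewrite powR_gt0.
move=> H; rewrite -(ler_pM2r xb) -(ler_pM2l (_ : 0 < (1 - b)^-1)); last lra.
have -> : (1 - b)^-1 * (((1 - b) * u * (x `^ b)^-1 + b * (x * (x `^ b)^-1)) * x `^ b)
  = u + b * x * (1 - b)^-1 by field; rewrite b1 gt_eqF.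
move: H; set y := u `^ _.
have -> : x + (1 - b)^-1 * x `^ b * (y - x * (x `^ b)^-1)
  = (1 - b)^-1 * (y * x `^ b) - b * x * (1 - b)^-1 by field; rewrite b1 gt_eqF.
by lra.
Qed.
Lemma jensen_powR (I : finType) (w f : I -> R) r :
  1 <= r -> (forall i, 0 <= w i) -> (forall i, 0 <= f i) ->
  (\sum_i w i * f i) `^ r <= (\sum_i w i) `^ (r - 1) * \sum_i w i * f i `^ r.
Proof.
move=> r1 w0 f0; have r0 : 0 < r by lra.
have : 0 <= \sum_i w i by exact: sumr_ge0.
rewrite le_eqVlt => /predU1P[/esym W0|W0].
  have -> : \sum_i w i * f i = 0.
    by apply: big1 => i _; move/psumr_eq0P : W0 => ->//; rewrite mul0r.
  rewrite powR0 ?gt_eqF//; apply: mulr_ge0; first exact: powR_ge0.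
  by apply: sumr_ge0 => i _; apply: mulr_ge0 => //; exact: powR_ge0.
set W := \sum_i w i in W0 *; set M := (\sum_i w i * f i) / W.
have WM : \sum_i w i * f i = W * M by rewrite /M mulrC divfK// gt_eqF.
have M0 : 0 <= M 
  by rewrite divr_ge0 ?(ltW W0)// sumr_ge0// => i _; rewrite mulr_ge0.
rewrite WM powRM ?(ltW W0)// -mulr_powRB1 ?(ltW W0)// mulrAC mulrC.
apply: ler_wpM2l; first exact: powR_ge0.
(* The tangents at the weighted mean [M] bound each f_i^r from below, and their linear terms sum to
   zero. *)
have -> : W * M `^ r = \sum_i w i * (M `^ r + r * M `^ (r - 1) * (f i - M)).
  under eq_bigr => i _.
    rewrite (_ : _ * _ = w i * (M `^ r - r * M `^ (r - 1) * M) +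
      r * M `^ (r - 1) * (w i * f i)); last by ring.
    over.
  by rewrite big_split/= -mulr_suml -mulr_sumr WM -/W; ring.
by apply: ler_sum => i _; rewrite ler_wpM2l// powR_ge_tangent.
Qed.

End RealPowers.

(** * Truncated gradients and one coordinate of a mirror step *)

Section Truncation.
Context {R : realType}.
Implicit Types g t : R.

(** Gradients here are prices minus 1, hence at least -1, so truncation acts only above 1;
    [clip_spec] records the two cases. *)
Definition clip g : R := if -1 <= g <= 1 then g else 1.

Variant clip_spec g : R -> Prop :=
| ClipSmall of g <= 1 : clip_spec g g
| ClipLarge of 1 < g : clip_spec g 1.

Lemma clipP g : -1 <= g -> clip_spec g (clip g).
Proof. by move=> g1; rewrite /clip g1/=; case: (lerP g 1) => ?; constructor. Qed.

Lemma clip_bounds g : -1 <= g -> -1 <= clip g <= 1.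
Proof. by move=> g1; case/clipP: (g1) => ?; apply/andP; split; lra. Qed.

(** The second-order error of a mirror step carries the price t as a weight; this bounds it by the
    first-order gain. For t <= 2 the slack is (2 - t) (t - 1)^2. *)
Lemma mul_sqr_clip_le t : 0 <= t ->
  t * clip (t - 1) ^+ 2 <= 2 * ((t - 1) * clip (t - 1)).
Proof.
move=> t0; have /clipP[t1|t1] : -1 <= t - 1 by lra.
  have : 0 <= (2 - t) * (t - 1) ^+ 2 by rewrite mulr_ge0 ?sqr_ge0//; lra.
  by rewrite expr2; lra.
by rewrite expr1n; lra.
Qed.

(* The loss from truncation and the second-order error of the mirror step are
   both paid for by the decrease of the objective. *)
Lemma clip_excess_le g c : -1 <= g -> 0 <= c <= 1 ->
  g - clip g + c * clip g ^+ 2 <= g * clip g.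
Proof.
move=> /clipP[g1|g1] c01; last by rewrite expr1n; lra.
have : 0 <= (1 - c) * g ^+ 2 by rewrite mulr_ge0 ?sqr_ge0//; lra.
by rewrite expr2; lra.
Qed.

Lemma norm_mul_clip_le g s : -1 <= g -> 0 <= s <= 1 -> `|s * clip g| <= 1.
Proof.
move=> g1 s01.
have /andP[c1 c2] := clip_bounds g1.
have : 0 <= s * (clip g + 1) by rewrite mulr_ge0//; lra.
have : 0 <= s * (1 - clip g) by rewrite mulr_ge0//; lra.
by rewrite ler_norml => ? ?; apply/andP; split; lra.
Qed.

(** One coordinate of the separable bound on the objective: t is the price, s the inverse dual
    variable, v the relative dual step. The first-order terms add up to - s g [clip] g / (16 q), and
    by [mul_sqr_clip_le] the quadratic error is at most a quarter of this, which leaves 3/4. *)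
Lemma mirror_decrease b' q t s :
  let g := t - 1 in let v := b' / (16 * q) * s * clip g in
  0 < b' <= 1 / 4 -> 1 <= q -> 0 <= t -> 0 <= s <= 1 ->
  t * (((1 + v) `^ (- b'^-1)) `^ q - 1) / q - ((1 + v) `^ (- b'^-1) - 1)
    <= - (3 / 4 * (16 * q)^-1 * s * (g * clip g)).
Proof.
move=> g v b'01 q1 t0 s01; have b0 : 0 < b' by lra.
have q0 : 0 < q by lra.
have qV0 : 0 < q^-1 by rewrite invr_gt0.
have b'V : 4 <= b'^-1 by rewrite -[4]invrK lef_pV2 ?posrE ?invr_gt0//; lra.
have g1 : -1 <= g by rewrite /g; lra.
have := norm_mul_clip_le g1 s01; rewrite ler_norml.
set th := s * clip g => /andP[th1 th2].
have vE : v = b' * (th / (16 * q)) by rewrite /v /th; field; lra.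
have thq : - (1 / 16) <= th / (16 * q) <= 1 / 16.
  by rewrite ler_pdivlMr ?ler_pdivrMr; [|lra|lra]; apply/andP; split; lra.
have v1 : -1 < v by rewrite vE; nra.
have lo : 1 - th / (16 * q) <= (1 + v) `^ (- b'^-1).
  have -> : th / (16 * q) = b'^-1 * v by rewrite vE; field; lra.
  by apply: powRN_ge_linear => //; lra.
have up : ((1 + v) `^ (- b'^-1)) `^ q <= 1 - th / 16 + 2 * (th / 16) ^+ 2.
  rewrite -powRrM mulNr.
  have E : b'^-1 * q * v = th / 16 by rewrite vE; field; lra.
  have := @powRN_le_quadratic _ v (b'^-1 * q); rewrite E; apply; first nra.
  by rewrite ler_norml; apply/andP; split; lra.
have : t * (((1 + v) `^ (- b'^-1)) `^ q - 1) / q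
    <= t * (- th / 16 + 2 * (th / 16) ^+ 2) / q.
  by rewrite ler_pM2r// ler_wpM2l//; lra.
have tc : t * th ^+ 2 <= 2 * (s * (g * clip g)).
  have h : s * (t * clip g ^+ 2) <= s * (2 * (g * clip g)).
    by rewrite ler_wpM2l ?mul_sqr_clip_le//; lra.
  have -> : t * th ^+ 2 = s * (s * (t * clip g ^+ 2)) by rewrite /th; ring.
  have h0 : 0 <= s * (t * clip g ^+ 2).
    by apply: mulr_ge0; [lra|apply: mulr_ge0 => //; exact: sqr_ge0].
  by apply: le_trans (_ : s * (t * clip g ^+ 2) <= _); nra.
have tc' : t * th ^+ 2 / q <= 2 * (s * (g * clip g)) / q by rewrite ler_pM2r.
have -> : - (3 / 4 * (16 * q)^-1 * s * (g * clip g))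
  = - (t * th / 16 / q) + th / 16 / q + 2 / 256 * (2 * (s * (g * clip g)) / q).
  by rewrite /th /g; field; lra.
have -> : t * (- th / 16 + 2 * (th / 16) ^+ 2) / q
  = - (t * th / 16 / q) + 2 / 256 * (t * th ^+ 2 / q) by field; lra.
have thE : th / (16 * q) = th / 16 / q by field; lra.
by rewrite thE in lo; lra.
Qed.

End Truncation.

(** * The objective and its gradient *)

Section Objective.
Context {R : realType} {m n : nat}.
Variables (A : 'M[R]_(m, n)) (alpha eps b : R).
Local Notation p := ((1 - alpha)^-1).
Implicit Types x u : 'I_n -> R.

Definition load x (i : 'I_m) : R := \sum_j A i j * x j `^ p.

Definition price x (j : 'I_n) : R :=
  (1 + eps / 2) `^ b^-1 * x j `^ (p - 1) *
    \sum_i A i j * load x i `^ b^-1.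

Definition penalty x : R :=
  (1 - alpha) * b / (1 + b) * (1 + eps / 2) `^ b^-1 *
    \sum_i load x i `^ ((1 + b) / b).

Definition objective x : R := penalty x - \sum_j x j.

End Objective.

Section Gradient.
Context {R : realType}.

(** Reduces a partial derivative to one real variable, where the chain rule for powers applies. *)
Lemma derive_line (V W : normedModType R) (f : V -> W) (a v : V) :
  'D_v f a = 'D_1 (fun h : R => f (h *: v + a)) (0 : R).
Proof.
rewrite /derive.
suff -> : (fun h : R => h^-1 *: ((f \o shift a) (h *: v) - f a)) =
    (fun h : R => h^-1 *: (((fun k : R => f (k *: v + a)) \o shift (0 : R))
      (h *: (1 : R)) - f ((0 : R) *: v + a))) by [].
by apply/funext => h /=; rewrite addr0 [h *: 1]mulr1 scale0r add0r.
Qed.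

(** Here s is the part of a load coming from the other coordinates and a the matrix entry. The case
    a = 0 is separate because the base s may then vanish, and the power rule is applied at positive
    bases. *)
Lemma is_derive_load_power (s a y p r : R) :
  0 <= s -> 0 <= a -> 0 < y -> 1 < r ->
  is_derive (0 : R) (1 : R) (fun h : R => (s + a * (h + y) `^ p) `^ r)
    (r * (s + a * y `^ p) `^ (r - 1) * (a * (p * y `^ (p - 1)))).
Proof.
move=> s0; rewrite le_eqVlt => /predU1P[<-|a0] y0 r1.
  rewrite !mul0r !mulr0.
  rewrite (_ : (fun _ => _) = cst ((s + 0) `^ r)); last first.
    by apply/funext => h; rewrite mul0r.
  exact: is_derive_cst.
have yp : 0 < y `^ p by rewrite powR_gt0.
pose g1 : R -> R := id + cst y.
have D1 : is_derive (0 : R) (1 : R) g1 (1 + 0) by apply: is_deriveD.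
have D2 : is_derive (0 : R) (1 : R) ((@powR R ^~ p) \o g1)
    (p * y `^ (p - 1) * (1 + 0)).
  have g10 : g1 0 = y by rewrite /g1 !fctE add0r.
  apply: is_derive1_comp; rewrite g10; exact: is_derive1_powR.
pose g2 : R -> R := cst s + a \*: ((@powR R ^~ p) \o g1).
have D3 : is_derive (0 : R) (1 : R) g2 (0 + a *: (p * y `^ (p - 1) * (1 + 0))).
  by apply: is_deriveD.
have g20 : g2 0 = s + a * y `^ p by rewrite /g2 /g1 !fctE /= add0r.
have D4 : is_derive (0 : R) (1 : R) ((@powR R ^~ r) \o g2)
    (r * (s + a * y `^ p) `^ (r - 1) * (0 + a *: (p * y `^ (p - 1) * (1 + 0)))).
  apply: is_derive1_comp; rewrite g20; apply: is_derive1_powR.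
  by rewrite ltr_wpDl// mulr_gt0.
by apply: is_derive_eq; rewrite add0r addr0 mulr1.
Qed.

Lemma derive_fr m n (A : 'M[R]_(m, n)) (rho alpha eps : R) (x : 'cV[R]_n) j :
  let b := beta m n rho alpha eps in
  (forall i k, 0 <= A i k) -> alpha < 1 -> 0 < b -> (forall k, 0 < x k 0) ->
  (1 - alpha) * 'D_(delta_mx j 0) (fr A rho alpha eps) x
  = price A alpha eps b (fun k => x k 0) j - 1.
Proof.
move=> b A0 al1 b0 x0; rewrite derive_line.
pose p := (1 - alpha)^-1; pose r := (1 + b) / b.
pose c : R := (1 + eps / 2) `^ b^-1 * b / (1 + b).
pose s i := \sum_(k | k != j) A i k * x k 0 `^ p.
have xE h k : (h *: delta_mx j 0 + x) k 0 = (if k == j then h else 0) + x k 0.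
  by rewrite !mxE andbT; case: eqP; rewrite ?mulr1 ?mulr0.
have s0 i : 0 <= s i by apply: sumr_ge0 => k _; rewrite mulr_ge0 ?powR_ge0.
have r1 : 1 < r by rewrite /r ltr_pdivlMr//; lra.
pose g i h := (s i + A i j * (h + x j 0) `^ p) `^ r.
have fE : (fun h : R => fr A rho alpha eps (h *: delta_mx j 0 + x)) =
    (- p) \*: (id + cst (\sum_k x k 0)) + c \*: (\sum_i g i).
  apply/funext => h; rewrite !fctE /fr -/b -/c -/r; congr (_ + _).
    rewrite [RHS](_ : _ = - ((h + \sum_k x k 0) / (1 - alpha))); last first.
      by rewrite [LHS]mulNr mulrC.
    congr (- (_ / _)).
    rewrite (bigD1 j)//= [in RHS](bigD1 j)//= xE eqxx addrA; congr (_ + _).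
    by apply: eq_bigr => k /negPf kj; rewrite xE kj add0r.
  rewrite fct_sumE; congr (_ * _); apply: eq_bigr => i _; congr (_ `^ _).
  rewrite mxE (bigD1 j)//= mxE xE eqxx addrC; congr (_ + _).
  by apply: eq_bigr => k /negPf kj; rewrite mxE xE kj add0r.
pose dg i := r * (s i + A i j * x j 0 `^ p) `^ (r - 1) *
  (A i j * (p * x j 0 `^ (p - 1))).
have Dg i : is_derive (0 : R) (1 : R) (g i) (dg i).
  exact: is_derive_load_power.
have D : is_derive (0 : R) (1 : R)
   ((- p) \*: (id + cst (\sum_k x k 0)) + c \*: (\sum_i g i))
   ((- p) *: (1 + 0) + c *: \sum_i dg i).
  apply: is_deriveD.
rewrite fE (@derive_val _ _ _ _ _ _ _ D) addr0.
have -> : (- p) *: (1 : R) = - p by exact: mulr1.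
rewrite mulrDr mulrN divff; last by lra.
rewrite addrC; congr (_ - _).
have -> : c *: (\sum_i dg i) = c * \sum_i dg i by [].
rewrite /price -/p !mulr_sumr; apply: eq_bigr => i _.
have -> : load A alpha (fun k => x k 0) i = s i + A i j * x j 0 `^ p.
  by rewrite /load (bigD1 j)//= addrC.
rewrite /dg (_ : r - 1 = b^-1); last by rewrite /r; field; lra.
by rewrite /c /r /p; field; rewrite !gt_eqF//; lra.
Qed.

End Gradient.

(** * Bregman divergence of the mirror map *)

Section Bregman.
Context {R : realType}.
Implicit Types u X : R.

(* Bregman divergence D(u, x) of the regularizer x - x^(1-b') / (1-b'), in
   terms of the dual variable X = x^(-b'). *)
Definition bregman (b' : R) u X : R :=
  u * X - u `^ (1 - b') / (1 - b') + b' / (1 - b') * X `^ (1 - b'^-1).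

(** This is the concave tangent inequality [powR1B_le] at x = X^(-1/b'). *)
Lemma bregman_ge0 (b' : R) u X : 0 < b' < 1 -> 0 <= u -> 0 < X -> 0 <= bregman b' u X.
Proof.
move=> b01 u0 X0; have b0 : b' != 0 by lra.
have := powR1B_le b01 u0 (powR_gt0 (- b'^-1) X0).
rewrite -!powRrM (_ : - b'^-1 * - b' = 1); last by field.
rewrite (_ : - b'^-1 * (1 - b') = 1 - b'^-1); last by field.
rewrite powRr1 ?(ltW X0)// /bregman; set y := X `^ _; set z := u `^ _ => H.
have -> : u * X - z / (1 - b') + b' / (1 - b') * y
  = ((1 - b') * u * X + b' * y - z) / (1 - b') by field; lra.
by rewrite divr_ge0//; lra.
Qed.

(** Bounds the starting term of the regret sum. The constant 32/21 is 4/3 * 8/7, from 1 / (1 - b')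
    <= 4/3 and X <= 8/7. *)
Lemma bregman_initial_le (b' : R) u X x : 0 < b' <= 1 / 4 -> 0 <= u <= 1 ->
  1 <= X <= 8 / 7 -> 0 <= x -> X `^ (1 - b'^-1) = X * x ->
  bregman b' u X <= u * (X - 1) + 32 / 21 * b' * x.
Proof.
move=> b01 /andP[u0 u1] X1 x0 E; rewrite /bregman E.
have uu : u <= u `^ (1 - b') / (1 - b').
  rewrite ler_pdivlMr; last by lra.
  apply: le_trans (_ : u <= _); first by nra.
  move: u0; rewrite le_eqVlt => /predU1P[<-|u0]; first exact: powR_ge0.
  by apply: ger1_powR; [rewrite u0|lra].
have : b' / (1 - b') * (X * x) <= 4 / 3 * b' * (8 / 7 * x).
  apply: ler_pM.
  - by apply: divr_ge0; lra.
  - by apply: mulr_ge0; lra.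
  - by rewrite ler_pdivrMr; nra.
  - by rewrite ler_wpM2r//; lra.
lra.
Qed.

(** Expanding the power of the dual variable to second order leaves an error quadratic in the
    truncated gradient; [clip_excess_le] absorbs it, together with the truncated part, into g *
    [clip] g. *)
Lemma bregman_step (b' eta : R) u X g : 0 < b' <= 1 / 4 -> 0 < eta <= 1 / 16 ->
  0 <= u -> 1 <= X -> -1 <= g ->
  let x := X `^ (- b'^-1) in
  eta * b' * (g * (x - u)) <=
    bregman b' u X - bregman b' u (X + eta * b' * clip g)
    + eta * b' * (x * (g * clip g)).
Proof.
move=> b01 e01 u0 X1 g1; set x := X `^ _ => /=; have b0 : b' != 0 by lra.
have X0 : 0 < X by lra.
have x0 : 0 < x by exact: powR_gt0.
set c := clip g; have /andP[c1 c2] : -1 <= c <= 1 by exact: clip_bounds.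
have bV : 4 <= b'^-1 by rewrite -[4]invrK lef_pV2 ?posrE ?invr_gt0//; lra.
pose s := X^-1; have s01 : 0 <= s <= 1.
  by rewrite /s invr_ge0 (ltW X0)/= invf_le1.
have sc : `|s * c| <= 1 by exact: norm_mul_clip_le.
have {sc}[sc1 sc2] : -1 <= s * c /\ s * c <= 1 by move: sc; rewrite ler_norml => /andP.
pose v := eta * b' * c / X.
have rv : (b'^-1 - 1) * v = (1 - b') * eta * (s * c).
  by rewrite /v /s; field; rewrite b0/= gt_eqF.
have r3 : 3 <= b'^-1 - 1 by lra.
have be : 0 <= (1 - b') * eta <= 1 / 16 by nra.
have rv16 : `|(b'^-1 - 1) * v| <= 1 / 16.
  by rewrite rv ler_norml; apply/andP; split; nra.
have v1 : -1 < v.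
  have -> : v = eta * b' * (s * c) by rewrite /v /s; ring.
  have : 0 <= eta * b' <= 1 / 16 by nra.
  by nra.
have X'E : X + eta * b' * c = X * (1 + v) by rewrite /v; field; rewrite gt_eqF.
have xX : X `^ (1 - b'^-1) = X * x.
  by rewrite /x powRD ?(gt_eqF X0) ?implybT// powRr1 ?ltW.
have up : (X + eta * b' * c) `^ (1 - b'^-1) <=
    X * x * (1 - (b'^-1 - 1) * v + 2 * ((b'^-1 - 1) * v) ^+ 2).
  rewrite X'E powRM; [|lra|lra].
  rewrite xX ler_pM2l ?mulr_gt0// (_ : 1 - b'^-1 = - (b'^-1 - 1)); last by ring.
  exact: powRN_le_quadratic.
have {up}up : b' / (1 - b') * (X + eta * b' * c) `^ (1 - b'^-1) <=
    b' / (1 - b') * (X * x) - eta * b' * x * c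
      + eta * b' * (x * (2 * (1 - b') * eta * s * c ^+ 2)).
  have h : 0 <= b' / (1 - b') by rewrite divr_ge0; lra.
  apply: le_trans (ler_wpM2l h up) _; rewrite rv le_eqVlt; apply/orP; left.
  by apply/eqP; rewrite /s; field; rewrite gt_eqF//=; lra.
have exc := @clip_excess_le R g (2 * (1 - b') * eta * s) g1.
have /exc{exc} : 0 <= 2 * (1 - b') * eta * s <= 1.
  have -> : 2 * (1 - b') * eta * s = 2 * ((1 - b') * eta) * s by ring.
  by apply/andP; split; nra.
rewrite -/c => exc.
have exc2 : x * (g - c + 2 * (1 - b') * eta * s * c ^+ 2) <= x * (g * c).
  by rewrite ler_pM2l.
(* Truncation only lowers the gradient, so at the comparison point u it costs nothing. *)
have gu : 0 <= u * (g - c).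
  by rewrite mulr_ge0// /c; case: (clipP g1) => ?; lra.
have eb : 0 <= eta * b' by nra.
have H : eta * b' * (x * (g - c + 2 * (1 - b') * eta * s * c ^+ 2)) <=
    eta * b' * (x * (g * c)) by rewrite ler_wpM2l.
have H2 : 0 <= eta * b' * (u * (g - c)) by rewrite mulr_ge0.
rewrite /bregman xX; lra.
Qed.

End Bregman.

(** * Convexity of the objective and its separable upper bound *)

Section ObjectiveTheory.
Context {R : realType} {m n : nat}.
Variables (A : 'M[R]_(m, n)) (alpha eps b : R).
Hypotheses (A0 : forall i j, 0 <= A i j) (al01 : 0 <= alpha < 1) (b0 : 0 < b).
Implicit Types x u w : 'I_n -> R.
Local Notation p := ((1 - alpha)^-1).
Local Notation r := ((1 + b) / b).
Local Notation q := ((1 + b) / ((1 - alpha) * b)).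
Local Notation kappa := ((1 + eps / 2) `^ b^-1).
Local Notation load := (load A alpha).
Local Notation price := (price A alpha eps b).
Local Notation penalty := (penalty A alpha eps b).
Local Notation objective := (objective A alpha eps b).

Lemma p_ge1 : 1 <= p.
Proof. by have := al01 => H; rewrite invf_ge1; lra. Qed.

Lemma r_gt1 : 1 < r.
Proof. by have := b0 => H; rewrite ltr_pdivlMr//; lra. Qed.

Lemma q_ge1 : 1 <= q.
Proof.
have [H1 H2] := (al01, b0); rewrite ler_pdivlMr; last by apply: mulr_gt0; lra.
nra.
Qed.

Lemma load_ge0 x i : 0 <= load x i.
Proof. by apply: sumr_ge0 => j _; rewrite mulr_ge0 ?powR_ge0. Qed.

Lemma price_ge0 x j : 0 <= price x j.
Proof.
rewrite /price mulr_ge0 ?mulr_ge0 ?powR_ge0// sumr_ge0// => i _.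
by rewrite mulr_ge0 ?powR_ge0.
Qed.

(** Here q = p * r is the degree of homogeneity of the penalty. *)
Lemma penalty_coef : (1 - alpha) * b / (1 + b) = q^-1.
Proof. by have [H1 H2] := (al01, b0); field; lra. Qed.

Lemma r1E : r - 1 = b^-1.
Proof. by have H := b0; field; lra. Qed.

Lemma mul_powR_p x j : 0 <= x j -> x j * x j `^ (p - 1) = x j `^ p.
Proof. by move=> x0; rewrite mulr_powRB1// invr_gt0; have := al01 => H; lra. Qed.

Lemma load_powR x i : load x i * load x i `^ b^-1 = load x i `^ r.
Proof.
have r0 : 0 < r by have := r_gt1; lra.
by have := mulr_powRB1 (load_ge0 x i) r0; rewrite r1E.
Qed.

Lemma sum_price x (f : 'I_n -> R) :
  \sum_j price x j * f j =
    kappa * \sum_i load x i `^ b^-1 * \sum_j A i j * x j `^ (p - 1) * f j.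
Proof.
under [in RHS]eq_bigr => i _ do rewrite mulr_sumr.
rewrite exchange_big/= mulr_sumr; apply: eq_bigr => j _.
rewrite /price -!mulrA; congr (_ * _); rewrite mulr_suml mulr_sumr.
by apply: eq_bigr => i _; ring.
Qed.

(** Euler's identity: the penalty is homogeneous of degree q and has the prices as partial
    derivatives. *)
Lemma penalty_price x : (forall j, 0 <= x j) ->
  penalty x = q^-1 * \sum_j price x j * x j.
Proof.
move=> x0; rewrite sum_price /penalty penalty_coef -mulrA; congr (_ * (_ * _)).
apply: eq_bigr => i _; rewrite -load_powR mulrC; congr (_ * _).
by apply: eq_bigr => j _; rewrite -mulrA [_ * x j]mulrC mul_powR_p.
Qed.

Lemma penalty_ge0 x : 0 <= penalty x.
Proof.
rewrite /penalty penalty_coef mulr_ge0 ?mulr_ge0 ?powR_ge0//.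
  by rewrite invr_ge0; have := q_ge1; lra.
by apply: sumr_ge0 => i _; exact: powR_ge0.
Qed.

(** Two tangent inequalities are composed, first for x_j^p inside the loads and then for the r-th
    power of each load, whose slope is nonnegative. *)
Lemma objective_ge_tangent x u : (forall j, 0 <= x j) -> (forall j, 0 <= u j) ->
  objective x + \sum_j (price x j - 1) * (u j - x j) <= objective u.
Proof.
move=> x0 u0.
have load_tan i : p * \sum_j A i j * x j `^ (p - 1) * (u j - x j)
    <= load u i - load x i.
  rewrite mulr_sumr -sumrB; apply: ler_sum => j _; rewrite -mulrBr.
  have := powR_ge_tangent p_ge1 (u0 j) (x0 j) => H.
  have -> : p * (A i j * x j `^ (p - 1) * (u j - x j)) =
    A i j * (p * x j `^ (p - 1) * (u j - x j)) by ring.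
  by rewrite ler_wpM2l//; lra.
have pen : penalty x + \sum_j price x j * (u j - x j) <= penalty u.
  rewrite sum_price /penalty penalty_coef.
  set S := \sum_i load x i `^ b^-1 * _.
  have -> : kappa * S = q^-1 * kappa * (r * p * S).
    by have [H1 H2] := (al01, b0); field; lra.
  rewrite -mulrDr.
  rewrite ler_wpM2l//.
    by rewrite mulr_ge0 ?powR_ge0// invr_ge0; have := q_ge1; lra.
  rewrite /S mulr_sumr -big_split/=; apply: ler_sum => i _.
  have H := powR_ge_tangent (ltW r_gt1) (load_ge0 u i) (load_ge0 x i).
  apply: le_trans H; rewrite r1E lerD2l.
  have -> : r * p * (load x i `^ b^-1 * \sum_j A i j * x j `^ (p - 1) * (u j - x j)) =
   r * load x i `^ b^-1 * (p * \sum_j A i j * x j `^ (p - 1) * (u j - x j)) by ring.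
  by rewrite ler_wpM2l// mulr_ge0 ?powR_ge0//; have := r_gt1; lra.
have -> : objective x + \sum_j (price x j - 1) * (u j - x j) =
    penalty x + \sum_j price x j * (u j - x j) - \sum_j u j.
  rewrite /objective -!addrA -!sumrN -!big_split/=; congr (_ + _).
  by apply: eq_bigr => j _; ring.
by rewrite lerD2r.
Qed.

(* Jensen's inequality for the loads makes the upper bound separable. *)
Lemma objective_scale_le x w : (forall j, 0 <= x j) -> (forall j, 0 <= w j) ->
  objective (fun j => x j * w j) <= objective x +
    \sum_j x j * (price x j * (w j `^ q - 1) / q - (w j - 1)).
Proof.
move=> x0 w0; have q1 := q_ge1; have r1 := r_gt1.
have pen : penalty (fun j => x j * w j) <=
    q^-1 * \sum_j price x j * (x j * w j `^ q).
  rewrite sum_price /penalty penalty_coef -mulrA !ler_wpM2l ?powR_ge0//.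
    by rewrite invr_ge0; lra.
  apply: ler_sum => i _.
  have -> : load (fun j => x j * w j) i = \sum_j (A i j * x j `^ p) * w j `^ p.
    by apply: eq_bigr => j _; rewrite powRM// mulrA.
  (* The weights A_ij x_j^p sum to the old load, so Jensen's prefactor is the power of the load that
     occurs in the prices. *)
  apply: le_trans (jensen_powR (ltW r1) _ _) _.
  - by move=> j; rewrite mulr_ge0 ?powR_ge0.
  - by move=> j; exact: powR_ge0.
  rewrite r1E ler_wpM2l ?powR_ge0// le_eqVlt; apply/orP; left; apply/eqP.
  apply: eq_bigr => j _; rewrite -powRrM (_ : p * r = q); last first.
    by have [H1 H2] := (al01, b0); field; lra.
  by rewrite -(mul_powR_p (x0 j)); ring.
apply: le_trans (_ : q^-1 * (\sum_j price x j * (x j * w j `^ q))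
  - \sum_j x j * w j <= _); first by rewrite /objective lerD2r.
rewrite /objective penalty_price// le_eqVlt; apply/orP; left; apply/eqP.
rewrite addrAC !mulr_sumr -!sumrB -big_split/= -sumrB.
by apply: eq_bigr => j _; have [H1 H2] := (al01, b0); field; lra.
Qed.

End ObjectiveTheory.

(** * Feasibility *)

Section Feasibility.
Context {R : realType} {m n : nat}.

Lemma exists_ge_average (f : 'I_n -> R) : (0 < n)%N ->
  exists j, \sum_k f k <= n%:R * f j.
Proof.
move=> n0; pose j0 := Ordinal n0.
case: (@Order.TotalTheory.arg_maxP _ _ _ j0 xpredT f erefl) => j _ fj.
exists j; apply: le_trans (ler_sum _ _) _.
  by move=> k _; exact: fj.
by rewrite sumr_const card_ord mulr_natl.
Qed.

(* A row that is nearly tight has a coordinate j carrying at least a 1/n share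
   of its load; the price of j is at least 2, so j shrinks at full speed, while
   the coordinates that may grow (price < 1) satisfy x_k^p <= Lam^-2. *)
Lemma feasible_step (A : 'M[R]_(m, n)) (rho alpha eps b a Lam : R)
    (x w sg : 'I_n -> R) :
  (forall i j, 0 <= A i j <= rho) -> (forall i j, A i j != 0 -> 1 <= A i j) ->
  (0 < n)%N -> 1 <= rho -> 0 <= alpha < 1 -> 0 < eps < 1 / 2 ->
  0 < a <= eps / 96 -> 8 * n%:R * rho <= Lam ->
  (forall i, 1 - eps / 8 < load A alpha x i -> Lam `^ (1 + alpha) <=
     (1 + eps / 2) `^ b^-1 * load A alpha x i `^ b^-1) ->
  (forall j, 0 < x j) -> (forall j, 0 <= w j) ->
  (forall i, load A alpha x i <= 1) ->
  (forall j, `|sg j| <= 1) ->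
  (forall j, 1 <= price A alpha eps b x j -> 0 <= sg j) ->
  (forall j, 2 <= price A alpha eps b x j ->
     (1 - eps) / (n%:R * rho) <= x j `^ (1 - alpha)^-1 -> 7 / 8 <= sg j) ->
  (forall j, w j `^ (1 - alpha)^-1 <= 1 - a * sg j + 2 * (a * sg j) ^+ 2) ->
  forall i, load A alpha (fun j => x j * w j) i <= 1.
Proof.
move=> A0r A1 n0 rho1 al e12 ar LamE hi x0 w0 ld sg1 sgp sg2 wp i.
set p := (1 - alpha)^-1 in wp sg2 *.
have A0 i' j : 0 <= A i' j by case/andP: (A0r i' j).
have Ar i' j : A i' j <= rho by case/andP: (A0r i' j).
have N1 : 1 <= n%:R :> R by rewrite ler1n.
have F0 j : 0 < x j `^ p by exact: powR_gt0.
have Nr : 1 <= n%:R * rho by nra.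
have Lam0 : 0 < Lam by lra.
have loadE : load A alpha (fun j => x j * w j) i =
    \sum_j A i j * x j `^ p * w j `^ p.
  by apply: eq_bigr => j _; rewrite -/p powRM ?(ltW (x0 j))// mulrA.
have sgb j : -1 <= sg j /\ sg j <= 1 by apply/andP; rewrite -ler_norml.
have sq j : (a * sg j) ^+ 2 <= a ^+ 2.
  have [s1 s2] := sgb j; rewrite exprMn ler_piMr ?sqr_ge0//.
  by rewrite expr2; nra.
(* A row with slack eps/8 stays feasible because a step multiplies its load by at most 1 + 2 a, with
   a <= eps/96. *)
have [lo|] := lerP (load A alpha x i) (1 - eps / 8).
  apply: le_trans (_ : load A alpha x i * (1 + 2 * a) <= _); last by nra.
  rewrite loadE /load mulr_suml; apply: ler_sum => j _.
  rewrite ler_wpM2l//; first by rewrite mulr_ge0// ltW.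
  apply: le_trans (wp j) _; have [s1 s2] := sgb j.
  by have := sq j; rewrite [a ^+ 2]expr2; nra.
move=> big; have {}hi := hi i big.
(* The price is at least the term of this nearly tight row; p - 1 = alpha * p distributes the power
   of [Lam] over the two factors. *)
have prx j : A i j != 0 ->
    (Lam * x j `^ p) `^ alpha * Lam <= price A alpha eps b x j.
  move=> /A1 Aij; rewrite /price -/p.
  have xE : x j `^ (p - 1) = (x j `^ p) `^ alpha.
    rewrite -powRrM; congr (_ `^ _); rewrite /p; field; lra.
  have -> : (Lam * x j `^ p) `^ alpha * Lam =
     x j `^ (p - 1) * Lam `^ (1 + alpha).
    rewrite powRM ?(ltW Lam0) ?(ltW (F0 j))// xE.
    rewrite powRD ?(gt_eqF Lam0) ?implybT// powRr1 ?(ltW Lam0)//; ring.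
  rewrite [_ * x j `^ (p - 1)]mulrC -[leRHS]mulrA ler_wpM2l ?powR_ge0//.
  apply: le_trans hi _; rewrite ler_wpM2l ?powR_ge0//.
  rewrite (bigD1 i)//= -[leLHS]addr0 lerD//.
    by rewrite ler_peMl ?powR_ge0.
  by apply: sumr_ge0 => k _; rewrite mulr_ge0 ?powR_ge0.
have small j : A i j * x j `^ p * (w j `^ p - 1) <= a / (32 * n%:R ^+ 2).
  have rhs0 : 0 <= a / (32 * n%:R ^+ 2).
    by apply: divr_ge0; [lra|nra].
  have [->|Aij] := eqVneq (A i j) 0; first by rewrite !mul0r.
  have [pr1|pr1] := lerP 1 (price A alpha eps b x j).
    apply: le_trans rhs0; rewrite mulr_ge0_le0//; first by rewrite mulr_ge0// ltW.
    have := wp j; have := sgp j pr1; have [_ s2] := sgb j; rewrite expr2.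
    have : 0 <= a * sg j <= 1 / 192 by have := sgp j pr1; nra.
    by nra.
  (* Otherwise the price would be at least Lam^(1-alpha) >= 1. The bound gives A_ij x_j^p <= rho /
     Lam^2 <= 1 / (64 n^2). *)
  have FL : Lam * x j `^ p < 1 / Lam.
    rewrite ltNge; apply/negP => FL; have := prx j Aij; apply/negP; rewrite -ltNge.
    apply: lt_le_trans pr1 _.
    have L1 : 1 <= Lam by lra.
    apply: le_trans (_ : (1 / Lam) `^ alpha * Lam <= _).
      rewrite div1r -powR_inv1 ?(ltW Lam0)// -powRrM.
      rewrite -[X in _ * X]powRr1 ?(ltW Lam0)// -powRD ?(gt_eqF Lam0) ?implybT//.
      by rewrite -[leLHS](powRr0 Lam) ler_powR//; lra.
    rewrite ler_pM2r// ge0_ler_powR ?nnegrE//; [lra|by rewrite divr_ge0 // ltW|].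
    by rewrite mulr_ge0 ?ltW.
  have wj : w j `^ p - 1 <= 2 * a.
    have [s1 s2] := sgb j.
    by have := sq j; have := wp j; rewrite [a ^+ 2]expr2; nra.
  have L64 : 64 * n%:R ^+ 2 * rho <= Lam ^+ 2.
    apply: le_trans (_ : (8 * n%:R * rho) ^+ 2 <= _).
      have -> : (8 * n%:R * rho) ^+ 2 = 64 * n%:R ^+ 2 * rho * rho by ring.
      by rewrite ler_peMr// !mulr_ge0// ?sqr_ge0//; lra.
    by rewrite ler_sqr ?nnegrE//; nra.
  apply: le_trans (_ : A i j * x j `^ p * (2 * a) <= _).
    by rewrite ler_wpM2l// mulr_ge0// ltW.
  have Fj : x j `^ p <= (Lam ^+ 2)^-1.
    by rewrite -(ler_pM2l Lam0) ltW//; apply: lt_le_trans FL _; rewrite le_eqVlt;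
     apply/orP; left; apply/eqP; field; rewrite gt_eqF.
  apply: le_trans (_ : rho * (Lam ^+ 2)^-1 * (2 * a) <= _).
    rewrite ler_wpM2r//; first lra.
    by apply: ler_pM => //; exact: ltW.
  have n20 : 0 < n%:R ^+ 2 :> R by rewrite exprn_gt0//; lra.
  have L20 : 0 < Lam ^+ 2 by rewrite exprn_gt0.
  rewrite ler_pdivlMr; last by lra.
  have -> : rho * (Lam ^+ 2)^-1 * (2 * a) * (32 * n%:R ^+ 2) =
    a * (64 * n%:R ^+ 2 * rho / Lam ^+ 2) by ring.
  by rewrite ler_piMr ?ler_pdivrMr ?mul1r//; lra.
have [j0 ldj] := exists_ge_average (fun j => A i j * x j `^ p) n0.
rewrite -[X in X <= _]/(load A alpha x i) in ldj.
have Aj0 : A i j0 != 0.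
  by apply/eqP => A0j; move: ldj; rewrite A0j mul0r mulr0; lra.
have Fj0 : 1 - eps / 8 <= n%:R * rho * x j0 `^ p.
  apply: le_trans (ltW big) _; apply: le_trans ldj _.
  by rewrite -mulrA ler_wpM2l// ler_pM2r.
have pr2 : 2 <= price A alpha eps b x j0.
  apply: le_trans (prx _ Aj0).
  have h1 : 1 <= Lam * x j0 `^ p.
    apply: le_trans (_ : 8 * (n%:R * rho * x j0 `^ p) <= _); first lra.
    by rewrite !mulrA ler_pM2r.
  have h2 : 1 <= (Lam * x j0 `^ p) `^ alpha.
    by rewrite -[leLHS](powRr0 (Lam * x j0 `^ p)) ler_powR//; lra.
  nra.
have sj0 : 7 / 8 <= sg j0.
  apply: sg2 => //; rewrite ler_pdivrMr; last by lra.
  by rewrite mulrC; lra.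
have wj0 : w j0 `^ p - 1 <= - (3 / 4) * a.
  have := wp j0; have [_ s2] := sgb j0.
  by have := sq j0; rewrite [a ^+ 2]expr2; nra.
(* The heavy coordinate carries at least 2 / (3 n) of the load and loses a fraction 3 a / 4 of it,
   that is a / (2 n); the others together gain at most a sixteenth of this. *)
have main : A i j0 * x j0 `^ p * (w j0 `^ p - 1) <= - (a / (2 * n%:R)).
  have h : (1 - eps / 8) / n%:R <= A i j0 * x j0 `^ p.
    rewrite ler_pdivrMr; last by lra.
    by rewrite [leRHS]mulrC; exact: le_trans (ltW big) ldj.
  have h2 : 1 / (2 * n%:R) * (4 / 3) <= A i j0 * x j0 `^ p.
    apply: le_trans h; rewrite ler_pdivlMr; last by lra.
    have -> : 1 / (2 * n%:R) * (4 / 3) * n%:R = 2 / 3 :> R by field; lra.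
    by lra.
  have -> : - (a / (2 * n%:R)) = 1 / (2 * n%:R) * (4 / 3) * (- (3 / 4) * a).
    by field; lra.
  apply: le_trans (_ : A i j0 * x j0 `^ p * (- (3 / 4) * a) <= _).
    by rewrite ler_wpM2l// mulr_ge0// ltW.
  by rewrite ler_wnM2r//; lra.
apply: le_trans (ld i); rewrite loadE -subr_le0 /load -sumrB.
have -> : \sum_j (A i j * x j `^ p * w j `^ p - A i j * x j `^ (1 - alpha)^-1) =
    \sum_j A i j * x j `^ p * (w j `^ p - 1).
  by apply: eq_bigr => j _; rewrite -/p; ring.
rewrite (bigD1 j0)//=.
have : \sum_(j < n | j != j0) A i j * x j `^ p * (w j `^ p - 1) <=
    n%:R * (a / (32 * n%:R ^+ 2)).
  apply: le_trans (_ : \sum_(j < n) a / (32 * n%:R ^+ 2) <= _); last first.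
    by rewrite sumr_const card_ord -[leLHS]mulr_natl.
  rewrite [leRHS](bigID (fun j => j != j0))/= -[leLHS]addr0 lerD//.
    by apply: ler_sum => j _.
  by apply: sumr_ge0 => j _; apply: divr_ge0; [lra|nra].
have -> : n%:R * (a / (32 * n%:R ^+ 2)) = (a / (2 * n%:R)) / 16 by field; lra.
have : 0 <= a / (2 * n%:R) by rewrite divr_ge0; lra.
lra.
Qed.

End Feasibility.

(** * Parameters *)

Section ParameterBounds.
Context {R : realType}.
Variables (m n : nat) (rho alpha eps : R).
Hypotheses (m0 : (0 < m)%N) (n0 : (0 < n)%N) (rho1 : 1 <= rho)
  (al01 : 0 <= alpha < 1) (e12 : 0 < eps < 1 / 2).
Local Notation lam := (4 * m%:R * n%:R * rho / eps).
Local Notation b := (beta m n rho alpha eps).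
Local Notation b' := (beta' n rho alpha eps).
Local Notation q := ((1 + b) / ((1 - alpha) * b)).
Local Notation eta := ((16 * q)^-1).
Local Notation h := (stepsize m n rho alpha eps).
Local Notation K := (num_iter m n rho alpha eps).

Lemma ln2_ge : 1 / 2 <= ln 2 :> R.
Proof. by have := @ln_ge_sub1V R 2 ltac:(lra); lra. Qed.

Lemma lam_ge : 8 * m%:R * n%:R * rho <= lam.
Proof.
have [[e0 e1] r1] := (andP e12, rho1).
have m1 : 1 <= m%:R :> R by rewrite ler1n.
have n1 : 1 <= n%:R :> R by rewrite ler1n.
have mn : 1 <= m%:R * n%:R :> R by nra.
have mnr : 1 <= m%:R * n%:R * rho by nra.
rewrite ler_pdivlMr//; nra.
Qed.

Lemma nrho_ge1 : 1 <= n%:R * rho.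
Proof.
have n1 : 1 <= n%:R :> R by rewrite ler1n.
by have r1 := rho1; nra.
Qed.

Lemma lam_ge_nrho : 8 * n%:R * rho <= lam.
Proof.
apply: le_trans lam_ge; have m1 : 1 <= m%:R :> R by rewrite ler1n.
by have := nrho_ge1; nra.
Qed.

Lemma ln_lam_ge : 3 / 2 <= ln lam.
Proof.
have l8 : 8 <= lam by apply: le_trans lam_ge_nrho; have := nrho_ge1; lra.
apply: le_trans (_ : ln 8 <= _); last by rewrite ler_ln ?posrE//; lra.
have -> : 8 = 2 ^+ 3 :> R by rewrite -natrX.
rewrite lnXn//; have := ln2_ge; lra.
Qed.

Lemma beta_bounds : 0 < b <= eps / 6.
Proof.
have [e H] := (e12, al01); have l := ln_lam_ge.
have d : 3 / 2 <= (1 + alpha) * ln lam by nra.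
by rewrite /beta divr_gt0 ?ler_pdivrMr//=; nra.
Qed.

Lemma betaVE : b^-1 = 4 * (1 + alpha) * ln lam / eps.
Proof.
have [e H] := (e12, al01); have l := ln_lam_ge.
by rewrite /beta; field; rewrite !gt_eqF//; lra.
Qed.

(** [beta] is calibrated for this identity: a relative change e^(eps/4) of a load is amplified to
    lam^(1+alpha). *)
Lemma expR_betaV : expR (eps / 4) `^ b^-1 = lam `^ (1 + alpha).
Proof.
have [e H] := (e12, al01).
have l0 : 0 < lam by have := lam_ge_nrho; have := nrho_ge1; lra.
rewrite -expRM powR_exp// betaVE; congr expR; field; lra.
Qed.

(** Follows from (1 + eps/2) (1 - eps/8) >= e^(eps/4). *)
Lemma price_high y : 1 - eps / 8 < y ->
  lam `^ (1 + alpha) <= (1 + eps / 2) `^ b^-1 * y `^ b^-1.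
Proof.
move=> y1; have e := e12; rewrite -expR_betaV -powRM; [|lra|lra].
have /andP[b0 _] := beta_bounds.
rewrite ge0_ler_powR ?nnegrE ?expR_ge0 ?invr_ge0//; [lra|nra|].
apply: le_trans (expR_le_quadratic _) _; [lra|rewrite expr2; nra].
Qed.

(** Follows from (1 + eps/2) (1 - 3 eps/4) <= 1 - eps/4 <= e^(-eps/4). *)
Lemma price_low y : 0 <= y <= 1 - 3 / 4 * eps ->
  (1 + eps / 2) `^ b^-1 * y `^ b^-1 <= lam^-1.
Proof.
move=> y01; have [e H] := (e12, al01).
have l8 : 8 <= lam by have := lam_ge_nrho; have := nrho_ge1; lra.
have l0 : 0 < lam by lra.
have /andP[b0 _] := beta_bounds.
rewrite -powRM; [|lra|lra].
apply: le_trans (_ : expR (- (eps / 4)) `^ b^-1 <= _).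
  rewrite ge0_ler_powR ?nnegrE ?expR_ge0 ?invr_ge0//; [lra|nra|].
  by apply: le_trans (expR_ge1Dx _); nra.
rewrite expRN -powR_inv1 ?expR_ge0// -powRrM [-1 * _]mulrC powRrM expR_betaV.
rewrite -powRrM -[leRHS]powR_inv1 ?(ltW l0)// ler_powR; lra.
Qed.

Lemma ln_nrho_ge : eps <= ln (n%:R * rho / (1 - eps)).
Proof.
have [e N] := (e12, nrho_ge1).
have i0 : 0 < (1 - eps)^-1 by rewrite invr_gt0; lra.
have := ln_ge_sub1V i0; rewrite invrK => l.
apply: le_trans (_ : ln (1 - eps)^-1 <= _); first lra.
have x0 : 0 < n%:R * rho / (1 - eps) by apply: divr_gt0; lra.
rewrite ler_ln ?posrE//; apply: ler_peMl => //; exact: ltW.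
Qed.

Lemma beta'_bounds : 0 < b' <= (1 - alpha) / 4.
Proof.
have [e H] := (e12, al01); have l := ln_nrho_ge.
have l0 : 0 < ln (n%:R * rho / (1 - eps)) by lra.
rewrite /beta' divr_gt0 ?ler_pdivrMr//=; last by nra.
have : (1 - alpha) * eps <= (1 - alpha) * ln (n%:R * rho / (1 - eps)).
  by rewrite ler_wpM2l//; lra.
lra.
Qed.

Lemma beta'_le : (1 < n)%N -> b' <= (1 - alpha) * eps / 2.
Proof.
move=> n1; have [e H] := (e12, al01).
have n2 : 2 <= n%:R :> R by rewrite ler_nat.
have l : 1 / 2 <= ln (n%:R * rho / (1 - eps)).
  apply: le_trans ln2_ge _; rewrite ler_ln ?posrE//.
    by rewrite ler_pdivlMr; [have := rho1; nra|lra].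
  by apply: divr_gt0; have := nrho_ge1; lra.
rewrite /beta' ler_pdivrMr; last by lra.
have : (1 - alpha) * eps / 2 * (1 / 2) <=
    (1 - alpha) * eps / 2 * ln (n%:R * rho / (1 - eps)).
  by rewrite ler_wpM2l//; nra.
lra.
Qed.

Definition dual_init : R := ((1 - eps) / (n%:R * rho)) `^ (1 - alpha) `^ (- b').

(** The logarithm in [beta'] cancels the one of the starting point, so the initial dual variable is
    close to 1 whatever n and rho are. *)
Lemma dual_initE : dual_init = expR ((1 - alpha) ^+ 2 * eps / 4).
Proof.
have [[e H] N] := (e12, al01, nrho_ge1); have l := ln_nrho_ge.
have x0 : 0 < n%:R * rho / (1 - eps) by apply: divr_gt0; lra.
have xV : (1 - eps) / (n%:R * rho) = (n%:R * rho / (1 - eps)) `^ (-1).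
  by rewrite powR_inv1 ?(ltW x0)// invf_div.
rewrite /dual_init xV -!powRrM powR_exp//.
by rewrite /beta'; congr expR; field; rewrite gt_eqF//; lra.
Qed.

(** The exponent is at most (1 - alpha) eps / 4 <= 1/8, where e^t <= 1 + 8/7 t; this gives 2/7 = 8/7
    * 1/4. *)
Lemma dual_init_bounds : 1 <= dual_init <= 1 + 2 / 7 * (1 - alpha) * eps.
Proof.
have [e H] := (e12, al01); rewrite dual_initE.
set t := _ / 4; have t0 : 0 <= t <= (1 - alpha) * eps / 4.
  have : 0 <= (1 - alpha) ^+ 2 * eps <= (1 - alpha) * eps.
    have : 0 <= (1 - alpha) ^+ 2 <= 1 - alpha by rewrite expr2; nra.
    by nra.
  by rewrite /t; lra.
have t8 : t <= 1 / 8 by nra.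
have := expR_ge1Dx t; have := expR_le_quadratic t8; rewrite expr2; nra.
Qed.

Lemma q_gt0 : 0 < q.
Proof.
have [H /andP[b0 _]] := (al01, beta_bounds).
by apply: divr_gt0; nra.
Qed.

Lemma eta_bounds : 0 < eta <= 1 / 16.
Proof.
have [H /andP[b0 b1]] := (al01, beta_bounds).
have q1 : 1 <= q by rewrite ler_pdivlMr; nra.
rewrite invr_gt0 mulr_gt0 ?q_gt0//= div1r lef_pV2 ?posrE; lra.
Qed.

(** Explains the step size: the dual increment is at most b' / (16 q), the scale at which the q-th
    power of a primal factor still has a quadratic expansion. *)
Lemma step_dual : eps * h = eta * b'.
Proof.
have [[e H] /andP[b0 _]] := (e12, al01, beta_bounds).
rewrite /stepsize; field; lra.
Qed.

Lemma num_iter_bounds :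
  2 / (eta * b' * (1 - alpha)) <= K%:R < 2 / (eta * b' * (1 - alpha)) + 1.
Proof.
have [H /andP[b0 _]] := (al01, beta'_bounds); have [/andP[e0 _] e] := (eta_bounds, e12).
rewrite -step_dual /num_iter.
rewrite (_ : h * (1 - alpha) * eps = eps * h * (1 - alpha)); last by ring.
set y := 2 / _; have y0 : 0 < y.
  have eb : 0 < eta * b' by rewrite mulr_gt0.
  by rewrite /y step_dual divr_gt0// mulr_gt0//; lra.
have c0 : (0 <= Num.ceil y)%R by rewrite -(ler_int R) (le_trans (ltW y0))// ceil_ge.
rewrite natr_absz ger0_norm// ceil_ge/=.
by have := ceilB1_lt y; rewrite intrD; lra.
Qed.

End ParameterBounds.

(** * Convergence *)

Section Iterates.
Context {R : realType} {m n : nat}.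
Variables (A : 'M[R]_(m, n)) (rho alpha eps : R).
Hypotheses (A0 : forall i j, 0 <= A i j) (A1 : forall i j, A i j != 0 -> 1 <= A i j)
  (Arho : forall i j, A i j <= rho) (Acol : forall j, exists i, A i j != 0)
  (m0 : (0 < m)%N) (n0 : (0 < n)%N) (rho1 : 1 <= rho)
  (al01 : 0 <= alpha < 1) (e12 : 0 < eps < 1 / 2).
Local Notation b := (beta m n rho alpha eps).
Local Notation b' := (beta' n rho alpha eps).
Local Notation p := ((1 - alpha)^-1).
Local Notation q := ((1 + b) / ((1 - alpha) * b)).
Local Notation eta := ((16 * q)^-1).
Local Notation h := (stepsize m n rho alpha eps).
Local Notation K := (num_iter m n rho alpha eps).
Local Notation load := (load A alpha).
Local Notation price := (price A alpha eps b).
Local Notation penalty := (penalty A alpha eps b).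
Local Notation objective := (objective A alpha eps b).
Local Notation X0 := (dual_init n rho alpha eps).

Let bb := beta_bounds m0 n0 rho1 al01 e12.
Let bb' := beta'_bounds n0 rho1 al01 e12.
Let X0b := dual_init_bounds n0 rho1 al01 e12.
Let etab := eta_bounds m0 n0 rho1 al01 e12.

Definition dual k (j : 'I_n) : R := 1 + z_iter A rho alpha eps k j 0.
(* The iterate x^(k+1): mirror steps are indexed from the dual variable. *)
Definition primal k (j : 'I_n) : R := dual k j `^ (- b'^-1).
Definition clipped k (j : 'I_n) : R := clip (price (primal k) j - 1).

Lemma x_iterE k j : x_iter A rho alpha eps k.+1 j 0 = primal k j.
Proof. by rewrite /= !mxE. Qed.

Lemma dual0 j : dual 0 j = X0.
Proof. by rewrite /dual /= !mxE /dual_init; ring. Qed.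

(** The first mirror step inverts the definition of z^(0), so x^(1) = x^(0). *)
Lemma primal0 j : primal 0 j = ((1 - eps) / (n%:R * rho)) `^ (1 - alpha).
Proof.
have [/andP[b'0 _] [/andP[_ e1] N]] := (bb', (e12, nrho_ge1 n0 rho1)).
rewrite /primal dual0 /dual_init -powRrM mulrNN divff ?gt_eqF// powRr1//.
exact: powR_ge0.
Qed.

Lemma dual_init_primal0 j : X0 `^ (1 - b'^-1) = X0 * primal 0 j.
Proof.
have X1 : 0 < X0 by have := X0b; lra.
rewrite powRD ?(gt_eqF X1) ?implybT// powRr1; last exact: ltW.
by rewrite /primal dual0.
Qed.

Lemma b'_le : 0 < b' <= 1 / 4.
Proof. by have [H1 H2] := (bb', al01); lra. Qed.

Lemma step_bounds : 0 < eta * b' <= 1 / 64.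
Proof.
have [/andP[e0 e1] /andP[b0 b1]] := (etab, b'_le); rewrite mulr_gt0//=.
have -> : 1 / 64 = 1 / 16 * (1 / 4) :> R by field.
by apply: ler_pM => //; exact: ltW.
Qed.

Lemma trunc_gradE (x : 'cV[R]_n) j : (forall l, 0 < x l 0) ->
  trunc_grad A rho alpha eps x j 0 = clip (price (fun l => x l 0) j - 1).
Proof.
move=> x0; have [/andP[b0 _] /andP[_ al1]] := (bb, al01).
have D := derive_fr j A0 al1 b0 x0.
by rewrite /trunc_grad mxE /clip -D.
Qed.

(** Positive dual variables give a positive primal point, where the partial derivatives of [fr] are
    expressed by prices. *)
Lemma dual_step k j : (forall j, 0 < dual k j) ->
  dual k.+1 j = dual k j + eta * b' * clipped k j.
Proof.
move=> d0; have [/andP[b0 _] H] := (bb, al01).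
rewrite /dual /= 2!mxE addrA (step_dual m0 n0 rho1 al01 e12); congr (_ + _ * _).
have xE : (fun l => mirror_point rho alpha eps (z_iter A rho alpha eps k) l 0)
    = primal k.
  by apply/funext => l; rewrite /mirror_point !mxE.
rewrite trunc_gradE ?xE// => l.
have -> : mirror_point rho alpha eps (z_iter A rho alpha eps k) l 0 = primal k l.
  by rewrite -xE.
exact/powR_gt0/d0.
Qed.

(** Each column has a nonzero entry, hence one that is at least 1, so x_j^p is at most the load of
    that row. *)
Lemma primal_le1 k j : (forall i, load (primal k) i <= 1) -> primal k j <= 1.
Proof.
move=> ld; have [i Aij] := Acol j; have H := al01.
have x0 : 0 <= primal k j by exact: powR_ge0.
have p0 : 0 < p by rewrite invr_gt0; lra.
rewrite leNgt; apply/negP => x1.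
have : 1 < load (primal k) i.
  apply: lt_le_trans (_ : primal k j `^ p <= _).
    exact: powR_gt1.
  rewrite /load (bigD1 j)//= -[leLHS]addr0 lerD//.
    by rewrite ler_peMl ?powR_ge0 ?A1.
  by apply: sumr_ge0 => l _; rewrite mulr_ge0 ?powR_ge0.
by rewrite ltNge ld.
Qed.

Lemma dual_ge1 k j : 0 < dual k j -> primal k j <= 1 -> 1 <= dual k j.
Proof.
move=> d0 x1; rewrite leNgt; apply/negP => d1; move: x1; apply/negP; rewrite -ltNge.
have /andP[b0 _] := bb'.
rewrite /primal powRN invf_gt1 ?powR_gt0//.
by rewrite powR_lt1 ?invr_gt0// d0.
Qed.

Definition feasible_iterate k :=
  (forall j, 1 <= dual k j) /\ (forall i, load (primal k) i <= 1).

Lemma grad_geN1 k j : -1 <= price (primal k) j - 1.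
Proof. by have := price_ge0 alpha eps b A0 (primal k) j; lra. Qed.

Section OneStep.
Variable k : nat.
Hypothesis inv : feasible_iterate k.
Local Notation s j := ((dual k j)^-1).
Local Notation v j := (b' / (16 * q) * s j * clipped k j).
Local Notation w j := ((1 + v j) `^ (- b'^-1)).

Let d1 : forall j, 1 <= dual k j := inv.1.

Lemma dual_inv_bounds j : 0 < s j <= 1.
Proof.
have H := d1 j; have d0 : 0 < dual k j by lra.
by rewrite invr_gt0 d0 invf_le1.
Qed.

Lemma norm_scaled_clip j : `|s j * clipped k j| <= 1.
Proof.
have H := dual_inv_bounds j; apply: norm_mul_clip_le; last by lra.
exact: grad_geN1.
Qed.

Lemma dual_stepM j : dual k.+1 j = dual k j * (1 + v j).
Proof.
have H := d1 j; have d0 : dual k j != 0 by lra.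
have q0 := q_gt0 m0 n0 rho1 al01 e12.
rewrite dual_step => [|l]; last by have := d1 l; lra.
by set Q := q in q0 *; field; rewrite d0/= gt_eqF.
Qed.

Lemma v_small j : -1 < v j.
Proof.
have := norm_scaled_clip j; rewrite ler_norml => /andP[H1 H2].
have -> : v j = eta * b' * (s j * clipped k j) by ring.
have := step_bounds.
by nra.
Qed.

Lemma primal_step j : primal k.+1 j = primal k j * w j.
Proof.
have H := d1 j; have H2 := v_small j.
by rewrite /primal dual_stepM powRM//; lra.
Qed.

Lemma dual_gt0 j : 0 < dual k.+1 j.
Proof.
have H := d1 j; have H2 := v_small j.
by rewrite dual_stepM mulr_gt0//; lra.
Qed.

Lemma primal_gt0 j : 0 < primal k j.
Proof. by rewrite powR_gt0//; have := d1 j; lra. Qed.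

(** The constant a is p / (16 q): loads see the p-th power of the mirror factor. *)
Lemma mirror_factor_powR j :
  let a := b / (16 * (1 + b)) in let sg := s j * clipped k j in
  w j `^ p <= 1 - a * sg + 2 * (a * sg) ^+ 2.
Proof.
set a := b / _; set sg := s j * _; rewrite /=.
have [H [B B']] := (al01, (bb, bb')).
have sg1 : -1 <= sg /\ sg <= 1 by apply/andP; rewrite -ler_norml norm_scaled_clip.
have a1 : 0 <= a <= 1 / 16.
  apply/andP; split; first by apply: divr_ge0; lra.
  by rewrite ler_pdivrMr; lra.
have rE : b'^-1 * p * v j = a * sg by have D := d1 j; rewrite /a /sg; field; lra.
rewrite -powRrM mulNr.
have := @powRN_le_quadratic _ (v j) (b'^-1 * p); rewrite rE; apply.
  have : 4 <= b'^-1 by rewrite -[4]invrK lef_pV2 ?posrE ?invr_gt0//; lra.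
  have : 1 <= p by rewrite invf_ge1; lra.
  by nra.
by rewrite ler_norml; apply/andP; split; nra.
Qed.

Lemma feasible_iterate_step : feasible_iterate k.+1.
Proof.
have [H [B B']] := (al01, (bb, bb')); have e := e12.
suff ld : forall i, load (primal k.+1) i <= 1.
  by split=> // j; apply: dual_ge1 (dual_gt0 j) (primal_le1 _ ld).
have E : primal k.+1 = (fun j => primal k j * w j).
  by apply/funext => j; exact: primal_step.
rewrite E.
apply: (@feasible_step _ _ _ A rho alpha eps b (b / (16 * (1 + b)))
  (4 * m%:R * n%:R * rho / eps) _ _ (fun j => s j * clipped k j)) => //.
- by move=> i j; rewrite A0 Arho.
- apply/andP; split; first by apply: divr_gt0; lra.
  by rewrite ler_pdivrMr; nra.
- exact: lam_ge_nrho.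
- by move=> i; exact: price_high.
- exact: primal_gt0.
- by move=> j; exact: powR_ge0.
- exact: inv.2.
- by move=> j; exact: norm_scaled_clip.
- move=> j pr1; have := dual_inv_bounds j.
  by rewrite /clipped; case: (clipP (grad_geN1 k j)) => ?; nra.
- move=> j pr2 xj.
  have -> : clipped k j = 1.
    by rewrite /clipped; case: (clipP (grad_geN1 k j)) => ?; lra.
  rewrite mulr1; have dj := d1 j.
  (* A coordinate not below its initial value has dual variable at most X0 <= 8/7, hence inverse at
     least 7/8. *)
  suff : dual k j <= X0.
    have XB : X0 <= 8 / 7 by have := X0b; nra.
    move=> dX; rewrite -[leLHS]invrK lef_pV2 ?posrE ?invr_gt0//; lra.
  have N := nrho_ge1 n0 rho1.
  have c0 : 0 <= (1 - eps) / (n%:R * rho) by rewrite divr_ge0; lra.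
  have /andP[b'0 _] := B'.
  have xx : ((1 - eps) / (n%:R * rho)) `^ (1 - alpha) <= primal k j.
    have := ge0_ler_powR (_ : 0 <= 1 - alpha) _ _ xj.
    rewrite -powRrM mulVf; last by lra.
    rewrite powRr1; last exact/ltW/primal_gt0.
    by apply; rewrite ?nnegrE ?powR_ge0//; lra.
  have -> : dual k j = primal k j `^ (- b').
    by rewrite /primal -powRrM mulrNN mulVf ?gt_eqF// powRr1//; lra.
  have y0 : 0 < ((1 - eps) / (n%:R * rho)) `^ (1 - alpha).
    by apply/powR_gt0/divr_gt0; lra.
  exact: le_powRN (ltW b'0) y0 xx.
- by move=> j; exact: mirror_factor_powR.
Qed.

Lemma objective_decrease :
  3 / 4 * eta * \sum_j primal k j * s j * ((price (primal k) j - 1) * clipped k j)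
    <= objective (primal k) - objective (primal k.+1).
Proof.
have [H [B B']] := (al01, (bb, bb')).
have E : primal k.+1 = (fun j => primal k j * w j).
  by apply/funext => j; exact: primal_step.
have /andP[b0 _] := bb.
have := objective_scale_le eps A0 H b0 (fun j => ltW (primal_gt0 j))
  (fun j => powR_ge0 (1 + v j) (- b'^-1)).
rewrite -E => le; rewrite -lerN2 opprB.
apply: le_trans (_ : \sum_j primal k j *
  (price (primal k) j * (w j `^ q - 1) / q - (w j - 1)) <= _); first by lra.
rewrite mulr_sumr -sumrN; apply: ler_sum => j _.
have q1 : 1 <= q by exact: q_ge1.
have s1 : 0 <= s j <= 1 by have := dual_inv_bounds j; lra.
have := mirror_decrease b'_le q1 (price_ge0 alpha eps b A0 (primal k) j) s1.
move/(ler_wpM2l (ltW (primal_gt0 j))) => /le_trans; apply.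
rewrite le_eqVlt; apply/orP; left; apply/eqP; rewrite /clipped; ring.
Qed.

Lemma regret_step u : (forall j, 0 <= u j) ->
  eta * b' * (objective (primal k) - objective u) <=
    \sum_j bregman b' (u j) (dual k j) - \sum_j bregman b' (u j) (dual k.+1 j)
    + eta * b' * \sum_j primal k j * ((price (primal k) j - 1) * clipped k j).
Proof.
move=> u0; have H := al01; have /andP[b0 _] := bb.
have := objective_ge_tangent eps A0 H b0 (fun j => ltW (primal_gt0 j)) u0.
move=> tan; have eb : 0 <= eta * b' by have := step_bounds; lra.
apply: le_trans (_ : eta * b' *
  \sum_j (price (primal k) j - 1) * (primal k j - u j) <= _).
  rewrite ler_wpM2l//.
  have -> : \sum_j (price (primal k) j - 1) * (primal k j - u j) =
     - \sum_j (price (primal k) j - 1) * (u j - primal k j).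
    by rewrite -sumrN; apply: eq_bigr => j _; ring.
  lra.
rewrite !mulr_sumr -sumrB -big_split/=; apply: ler_sum => j _.
rewrite dual_step => [|l]; last by have := d1 l; lra.
exact: bregman_step b'_le etab (u0 j) (d1 j) (grad_geN1 k j).
Qed.

(** The regret error has weights x_j and the guaranteed decrease has weights x_j / dual_j; a bound
    on the dual variables compares them. *)
Lemma excess_le M : (forall j, dual k j <= M) ->
  \sum_j primal k j * ((price (primal k) j - 1) * clipped k j) <=
  M * \sum_j primal k j * s j * ((price (primal k) j - 1) * clipped k j).
Proof.
move=> dM; rewrite mulr_sumr; apply: ler_sum => j _.
have x0 := primal_gt0 j; have D := d1 j; have /andP[s0 _] := dual_inv_bounds j.
have gc : 0 <= (price (primal k) j - 1) * clipped k j.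
  rewrite /clipped; case: (clipP (grad_geN1 k j)) => ?; last lra.
  by rewrite -expr2 sqr_ge0.
set y := _ * clipped k j in gc *.
have -> : M * (primal k j * s j * y) = (M * s j) * (primal k j * y) by ring.
rewrite ler_peMl//; first by rewrite mulr_ge0// ltW.
by rewrite ler_pdivlMr ?mul1r//; lra.
Qed.

End OneStep.

Lemma load_primal0 i : load (primal 0) i <= 1 - eps.
Proof.
have [H N] := (al01, nrho_ge1 n0 rho1); have e := e12.
have c0 : 0 <= (1 - eps) / (n%:R * rho) by rewrite divr_ge0; lra.
apply: le_trans (_ : \sum_(j < n) rho * ((1 - eps) / (n%:R * rho)) <= _).
  apply: ler_sum => j _; rewrite primal0 -powRrM divff; last by lra.
  by rewrite powRr1// ler_wpM2r.
rewrite sumr_const card_ord -mulr_natl.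
have [r1 n1] : 1 <= rho /\ 1 <= n%:R :> R by rewrite rho1 ler1n.
by rewrite le_eqVlt; apply/orP; left; apply/eqP; field; lra.
Qed.

Lemma feasible_iterateP k : feasible_iterate k.
Proof.
elim: k => [|k IH]; last exact: feasible_iterate_step.
split=> [j|i]; first by rewrite dual0; case/andP: X0b.
by apply: le_trans (load_primal0 i) _; have := e12; lra.
Qed.

Lemma objective_nonincreasing k : objective (primal k.+1) <= objective (primal k).
Proof.
have := objective_decrease (feasible_iterateP k); set S := \sum_j _.
have : 0 <= S.
  apply: sumr_ge0 => j _; have /andP[s0 _] := dual_inv_bounds (feasible_iterateP k) j.
  have x0 := primal_gt0 (feasible_iterateP k) j.
  apply: mulr_ge0; first by rewrite mulr_ge0// ltW.
  rewrite /clipped; case: (clipP (grad_geN1 k j)) => ?; last lra.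
  by rewrite -expr2 sqr_ge0.
by have := etab; nra.
Qed.

Lemma objective_le0 k : objective (primal k) <= objective (primal 0).
Proof. by elim: k => // k IH; apply: le_trans IH; exact: objective_nonincreasing. Qed.

Lemma dual_growth k j : dual k j <= X0 + k%:R * (eta * b').
Proof.
elim: k => [|k IH]; first by rewrite dual0 mul0r addr0.
rewrite dual_step => [|l]; last by have := (feasible_iterateP k).1 l; lra.
have eb : 0 <= eta * b' by have := step_bounds; lra.
have /andP[_ c1] := clip_bounds (grad_geN1 k j).
by rewrite -[k.+1%:R]natr1; have := ler_wpM2l eb c1; rewrite -/(clipped k j); lra.
Qed.

(** Each step's error is at most a constant times that step's decrease of the objective, so the
    errors telescope along with the divergences. Monotonicity of the objective moves the whole sum
    to the last iterate. *)
Lemma regret u k : (forall j, 0 <= u j) -> (k <= K)%N ->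
  k%:R * (eta * b') * (objective (primal k) - objective u) <=
    \sum_j bregman b' (u j) X0 - \sum_j bregman b' (u j) (dual k j)
    + 4 / 3 * b' * (X0 + 2 / (1 - alpha)) *
      (objective (primal 0) - objective (primal k)).
Proof.
move=> u0; elim: k => [_|k IH kK].
  have -> : \sum_j bregman b' (u j) (dual 0 j) = \sum_j bregman b' (u j) X0.
    by apply: eq_bigr => j _; rewrite dual0.
  by rewrite !mul0r !subrr mulr0 addr0.
have {IH} := IH (ltnW kK); have inv := feasible_iterateP k.
have [H [/andP[eta0 _] /andP[b'0 _]]] := (al01, (etab, bb')).
have /andP[eb _] := step_bounds.
set M := X0 + 2 / (1 - alpha).
(* Since k + 1 <= K and the ceiling adds less than 1, k steps contribute at most 2 / (1 - alpha). *)
have dM j : dual k j <= M.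
  apply: le_trans (dual_growth k j) _; rewrite lerD2l.
  have /andP[_] := num_iter_bounds m0 n0 rho1 al01 e12.
  have : k.+1%:R <= K%:R :> R by rewrite ler_nat.
  rewrite -[k.+1%:R]natr1 => kK' KU.
  have : k%:R <= 2 / (eta * b' * (1 - alpha)) by lra.
  move/(ler_wpM2r (ltW eb)) => /le_trans; apply.
  rewrite le_eqVlt; apply/orP; left; apply/eqP.
  by move: eta0 b'0; set E := eta; set B' := b' => ? ?; field; lra.
have M0 : 0 <= M.
  exact: le_trans (le_trans ler01 (inv.1 (Ordinal n0))) (dM _).
have := regret_step inv u0; have := excess_le inv dM.
have := objective_decrease inv; have := objective_nonincreasing k.
set S1 := \sum_j primal k j * _ * _; set S2 := \sum_j primal k j * _.
set f1 := objective (primal k.+1); set f := objective (primal k).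
set fu := objective u; set f0 := objective (primal 0).
set B1 := \sum_j bregman _ _ (dual k.+1 j); set B := \sum_j bregman _ _ (dual k j).
move=> mon dec exc reg IH.
have kE : 0 <= k%:R * (eta * b') by rewrite mulr_ge0// ltW.
have h1 : k%:R * (eta * b') * (f1 - fu) <= k%:R * (eta * b') * (f - fu).
  by rewrite ler_wpM2l//; lra.
have h2 : eta * b' * (f1 - fu) <= eta * b' * (f - fu).
  by rewrite ler_wpM2l// ?(ltW eb)//; lra.
have h3 : eta * b' * S2 <= 4 / 3 * b' * M * (f - f1).
  have : eta * b' * S2 <= eta * b' * (M * S1) by rewrite ler_wpM2l// ltW.
  have : 4 / 3 * b' * M * (3 / 4 * eta * S1) <= 4 / 3 * b' * M * (f - f1).
    by rewrite ler_wpM2l// mulr_ge0//; lra.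
  lra.
rewrite -[k.+1%:R]natr1; lra.
Qed.

End Iterates.

(* N stands for K eta b', I, U, P for the sums of the coordinates of the initial
   point, of the shrunk optimum and of the output, and f0, fu, fK for the values
   of the objective there. *)
Lemma regret_arith (R : realType) (a e b' X N S I U P f0 fu fK : R) :
  0 < a <= 1 -> 0 < e < 1 / 2 -> 0 < b' <= a * e / 2 ->
  1 <= X <= 1 + 2 / 7 * a * e -> 2 / a <= N ->
  0 <= I <= S -> 0 <= U <= S -> (1 - 6 / 5 * a * e) * S <= U ->
  f0 <= 0 -> fu <= - (1 - a * e / 48) * U -> - P <= fK -> P <= S ->
  N * (fK - fu) <= (X - 1) * U + 32 / 21 * b' * I
    + 4 / 3 * b' * (X + 2 / a) * (f0 - fK) ->
  (1 - 3 * e * a) * S <= P.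
Proof.
move=> a01 e12 be X1 Na I0 U0 US f00 fuU PK PS reg.
have S0 : 0 <= S by lra.
have aeS : 0 <= a * e * S by apply: mulr_ge0 => //; apply: mulr_ge0; lra.
have a8 : a * e <= 1 / 2 by nra.
have aX : 0 <= a * (X + 2 / a) <= 22 / 7.
  have -> : a * (X + 2 / a) = a * X + 2 by field; lra.
  by nra.
have bI : b' * I <= a * e / 2 * S by apply: ler_pM; lra.
have bf : b' * (f0 - fK) <= a * e / 2 * S.
  apply: le_trans (_ : b' * S <= _); first by rewrite ler_wpM2l//; lra.
  by rewrite ler_wpM2r//; lra.
have XU : (X - 1) * U <= 2 / 7 * a * e * S by apply: ler_pM; lra.
have gap : fK - fu <= (37 / 70 + 22 / 21) * (a * e * S).
  (* Only a positive gap needs the regret; then N may be replaced by its lower bound 2 / a. *)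
  have [le|lt] := lerP (fK - fu) 0; first lra.
  have h1 : 2 / a * (fK - fu) <= N * (fK - fu) by rewrite ler_pM2r.
  have h2 : 2 * (fK - fu) <= a * ((X - 1) * U + 32 / 21 * b' * I) +
      4 / 3 * (a * (X + 2 / a)) * (b' * (f0 - fK)).
    have -> : 2 * (fK - fu) = a * (2 / a * (fK - fu)) by field; lra.
    have -> : a * ((X - 1) * U + 32 / 21 * b' * I) +
      4 / 3 * (a * (X + 2 / a)) * (b' * (f0 - fK)) =
      a * ((X - 1) * U + 32 / 21 * b' * I + 4 / 3 * b' * (X + 2 / a) * (f0 - fK)).
      by ring.
    by rewrite ler_pM2l; lra.
  have h3 : a * (X + 2 / a) * (b' * (f0 - fK)) <= 22 / 7 * (a * e / 2 * S).
    apply: le_trans (_ : a * (X + 2 / a) * (a * e / 2 * S) <= _).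
      by rewrite ler_wpM2l//; lra.
    by rewrite ler_wpM2r//; lra.
  have h4 : a * ((X - 1) * U + 32 / 21 * b' * I) <= 1 * (37 / 35 * (a * e * S)).
    apply: le_trans (_ : a * (37 / 35 * (a * e * S)) <= _).
      by rewrite ler_wpM2l//; lra.
    by rewrite ler_wpM2r//; lra.
  lra.
(* In units of a e S the losses are 6/5 from shrinking the optimum, 1/48 from its penalty and 37/70
   + 22/21 from the regret, in total below 3. *)
have : a * e / 48 * U <= a * e / 48 * S by rewrite ler_wpM2l//; lra.
lra.
Qed.

(** * Quality of the output *)

Section Quality.
Context {R : realType} {m n : nat}.
Variables (A : 'M[R]_(m, n)) (rho alpha eps : R).
Local Notation b := (beta m n rho alpha eps).
Local Notation b' := (beta' n rho alpha eps).
Local Notation p := ((1 - alpha)^-1).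
Local Notation q := ((1 + b) / ((1 - alpha) * b)).
Local Notation eta := ((16 * q)^-1).
Local Notation K := (num_iter m n rho alpha eps).
Local Notation load := (load A alpha).
Local Notation price := (price A alpha eps b).
Local Notation penalty := (penalty A alpha eps b).
Local Notation objective := (objective A alpha eps b).
Local Notation X0 := (dual_init n rho alpha eps).
Local Notation primal := (primal A rho alpha eps).

(** A Bernoulli-type bound, obtained by writing 1 - d as the inverse of 1 + d / (1 - d). *)
Lemma powR1B_ge (d r : R) : 0 <= d < 1 -> 0 <= r ->
  1 - r * (d / (1 - d)) <= (1 - d) `^ r.
Proof.
move=> d01 r0; have v0 : 0 <= d / (1 - d) by rewrite divr_ge0; lra.
have := @powRN_ge_linear _ (d / (1 - d)) r ltac:(lra) r0.
rewrite (_ : 1 + d / (1 - d) = (1 - d) `^ (-1)); last first.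
  by rewrite powR_inv1; [field; lra|lra].
by rewrite -powRrM mulrNN mul1r.
Qed.

Hypotheses (A0 : forall i j, 0 <= A i j) (A1 : forall i j, A i j != 0 -> 1 <= A i j)
  (Arho : forall i j, A i j <= rho) (Acol : forall j, exists i, A i j != 0)
  (m0 : (0 < m)%N) (n0 : (0 < n)%N) (rho1 : 1 <= rho)
  (al01 : 0 <= alpha < 1) (e12 : 0 < eps < 1 / 2).

Let bb := beta_bounds m0 n0 rho1 al01 e12.
Let bb' := beta'_bounds n0 rho1 al01 e12.

(** By Euler's identity the penalty is the sum of price_j x_j divided by q. Here the prices are at
    most m rho / lam <= 1/8 and 1/q <= (1 - alpha) eps / 6. *)
Lemma penalty_low_load (x : 'I_n -> R) : (forall j, 0 <= x j <= 1) ->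
  (forall i, load x i <= 1 - 3 / 4 * eps) ->
  penalty x <= (1 - alpha) * eps / 48 * \sum_j x j.
Proof.
move=> x01 ld; have [H [/andP[b0 b1] e]] := (al01, (bb, e12)).
have x0 j : 0 <= x j by case/andP: (x01 j).
have lam0 : 0 < 4 * m%:R * n%:R * rho / eps.
  by have := lam_ge_nrho m0 n0 rho1 e12; have := nrho_ge1 n0 rho1; lra.
have pr j : price x j <= 1 / 8.
  rewrite /price mulrAC; apply: le_trans (_ : (1 + eps / 2) `^ b^-1 *
    \sum_i A i j * load x i `^ b^-1 <= _).
    rewrite ler_piMr//; last first.
      have := ge0_ler_powR (_ : 0 <= p - 1) _ _ (_ : x j <= 1).
      rewrite powR1; apply; rewrite ?nnegrE//; last by case/andP: (x01 j).
      by rewrite subr_ge0 invf_ge1; lra.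
    rewrite mulr_ge0 ?powR_ge0// sumr_ge0// => i _.
    by rewrite mulr_ge0 ?powR_ge0.
  rewrite mulr_sumr; apply: le_trans
    (_ : \sum_(i < m) rho * (4 * m%:R * n%:R * rho / eps)^-1 <= _).
    apply: ler_sum => i _; rewrite mulrCA; apply: ler_pM => //.
      by rewrite mulr_ge0 ?powR_ge0.
    by apply: price_low => //; rewrite load_ge0//= ld.
  rewrite sumr_const card_ord -[leLHS]mulr_natl mulrA ler_pdivrMr//.
  have := lam_ge m0 n0 rho1 e12; have n1 : 1 <= n%:R :> R by rewrite ler1n.
  have : m%:R * rho <= m%:R * rho * n%:R.
    by rewrite ler_peMr// mulr_ge0//; have := rho1; lra.
  lra.
have qV : q^-1 <= (1 - alpha) * eps / 6.
  rewrite -(penalty_coef al01 b0) ler_pdivrMr; last by lra.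
  have a0 : 0 <= 1 - alpha by lra.
  have := ler_wpM2l a0 b1.
  have : 0 <= (1 - alpha) * eps * b.
    by apply: mulr_ge0; [apply: mulr_ge0; lra|lra].
  lra.
rewrite (penalty_price eps A0 al01 b0 x0) mulr_sumr mulr_sumr; apply: ler_sum => j _.
rewrite mulrA ler_wpM2r//.
have -> : (1 - alpha) * eps / 48 = (1 - alpha) * eps / 6 * (1 / 8) by field.
apply: ler_pM => //; last exact: price_ge0.
by rewrite invr_ge0 ltW// q_gt0.
Qed.

Variable xstar : 'cV[R]_n.
Hypothesis opt : fair_packing_optimal A alpha xstar.
Local Notation S := (\sum_j xstar j 0 `^ (1 - alpha)).

Lemma sum_le_optimum (x : 'I_n -> R) : (forall j, 0 <= x j) ->
  (forall i, load x i <= 1) -> \sum_j x j <= S.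
Proof.
move=> x0 ld; have H := al01; pose y : 'cV[R]_n := \col_j (x j `^ p).
have yf : packing_feasible A y.
  split=> [i|j]; last by rewrite mxE powR_ge0.
  apply: le_trans (ld i); rewrite mxE le_eqVlt; apply/orP; left; apply/eqP.
  by apply: eq_bigr => j _; rewrite mxE.
have := opt.2 y yf; rewrite /fair_utility -!mulr_suml ler_pM2r; last first.
  by rewrite invr_gt0; lra.
apply: le_trans; rewrite le_eqVlt; apply/orP; left; apply/eqP.
apply: eq_bigr => j _; rewrite mxE -powRrM mulVf; last by lra.
by rewrite powRr1.
Qed.

Lemma optimum_ge0 : 0 <= S.
Proof. by apply: sumr_ge0 => j _; exact: powR_ge0. Qed.

Lemma optimum_le1 j : xstar j 0 <= 1.
Proof.
have [[ax x0] _] := opt; have [i Aij] := Acol j.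
apply: le_trans (ax i); rewrite mxE (bigD1 j)//= -[leLHS]addr0 lerD//.
  by rewrite ler_peMl ?A1.
by apply: sumr_ge0 => l _; rewrite mulr_ge0.
Qed.

Lemma load_primal k i : load (primal k) i <= 1.
Proof. exact: (feasible_iterateP A0 A1 Arho Acol m0 n0 rho1 al01 e12 k).2. Qed.

Lemma primal_ge0 k j : 0 <= primal k j.
Proof. exact: powR_ge0. Qed.

Lemma objective0_le : objective (primal 0) <=
  - (1 - (1 - alpha) * eps / 48) * \sum_j primal 0 j.
Proof.
have x01 j : 0 <= primal 0 j <= 1.
  rewrite primal_ge0/=; apply: (primal_le1 A0 A1 Acol al01) => i.
  exact: load_primal.
have ld i : load (primal 0) i <= 1 - 3 / 4 * eps.
  apply: le_trans (load_primal0 Arho n0 rho1 al01 e12 i) _.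
  by have := e12; lra.
by have := penalty_low_load x01 ld; rewrite /objective; lra.
Qed.

Lemma sum_primal_ge_objective k : - objective (primal k) <= \sum_j primal k j.
Proof.
have [H /andP[b0 _]] := (al01, bb).
by have := penalty_ge0 A eps H b0 (primal k); rewrite /objective; lra.
Qed.

(* For n = 1 the starting point is the optimum shrunk by the factor 1 - eps. *)
Lemma primal_quality_dim1 : n = 1%N -> (exists i j, A i j = rho) ->
  (1 - 3 * eps * (1 - alpha)) * S <= \sum_j primal K j.
Proof.
move=> n1 [i [j0 Aij0]]; have [H e] := (al01, e12); have r1 := rho1.
have [[ax xs0] _] := opt.
have S0 := optimum_ge0.
have nR : n%:R = 1 :> R by rewrite n1.
have xr j : xstar j 0 <= 1 / rho.
  have l0 (l : 'I_n) : l = 0%N :> nat.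
    by apply/eqP; rewrite -leqn0 -ltnS (leq_trans (ltn_ord l)) ?n1.
  have jE l : l = j0 by apply: val_inj; rewrite /= !l0.
  rewrite (jE j) ler_pdivlMr; last by lra.
  apply: le_trans (ax i); rewrite mxE (bigD1 j0)//= Aij0 mulrC -[leLHS]addr0 lerD//.
  by apply: sumr_ge0 => l _; rewrite mulr_ge0.
have P0 : (1 - 2 * (1 - alpha) * eps) * S <= \sum_j primal 0 j.
  apply: le_trans (_ : (1 - eps) `^ (1 - alpha) * S <= _).
    rewrite ler_wpM2r//; apply: le_trans (powR1B_ge _ _); [|lra|lra].
    have : eps / (1 - eps) <= 2 * eps by rewrite ler_pdivrMr; [nra|lra].
    by move/(ler_wpM2l (_ : 0 <= 1 - alpha)); lra.
  rewrite mulr_sumr; apply: ler_sum => j _.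
  rewrite primal0// -powRM//; last by lra.
  apply: (ge0_ler_powR (_ : 0 <= 1 - alpha)); rewrite ?nnegrE.
  - by lra.
  - by apply: mulr_ge0 => //; lra.
  - by rewrite nR mul1r; apply: divr_ge0; lra.
  - rewrite nR mul1r ler_wpM2l//; first by lra.
    by have := xr j; rewrite div1r.
(* The output's sum is at least minus its objective, which is no smaller than minus the initial
   objective; the penalty at the start is negligible. *)
have PK := sum_primal_ge_objective K.
have mono := objective_le0 A0 A1 Arho Acol m0 n0 rho1 al01 e12 K.
have ob0 := objective0_le.
have SI : \sum_j primal 0 j <= S.
  by apply: sum_le_optimum => [j|l]; [exact: primal_ge0|exact: load_primal].
have ae : 0 <= (1 - alpha) * eps by apply: mulr_ge0; lra.
have := ler_wpM2l ae SI; have := mulr_ge0 ae S0.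
lra.
Qed.

Lemma steps_ge : 2 / (1 - alpha) <= K%:R * (eta * b').
Proof.
have /andP[eb _] := step_bounds m0 n0 rho1 al01 e12.
have /andP[/(ler_wpM2r (ltW eb)) + _] := num_iter_bounds m0 n0 rho1 al01 e12.
apply: le_trans; rewrite le_eqVlt; apply/orP; left; apply/eqP.
by move: eb; have := al01; set E := eta * b' => ? ?; field; lra.
Qed.

Lemma primal_quality : (1 < n)%N ->
  (1 - 3 * eps * (1 - alpha)) * S <= \sum_j primal K j.
Proof.
move=> n1; have [[H e] [B B']] := (al01, e12, (bb, bb')).
have [b'0 bq] : 0 < b' /\ b' <= 1 / 4 by lra.
have b'e := beta'_le n0 rho1 al01 e12 n1.
have X0b := dual_init_bounds n0 rho1 al01 e12.
have [[ax xs0] _] := opt.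
pose d := 3 / 4 * eps; pose u j := ((1 - d) * xstar j 0) `^ (1 - alpha).
have d1 : 0 <= d < 1 by rewrite /d; lra.
have u0 j : 0 <= u j by exact: powR_ge0.
have dx j : 0 <= (1 - d) * xstar j 0 <= 1.
  by rewrite mulr_ge0 ?mulr_ile1 ?optimum_le1//; lra.
have u1 j : 0 <= u j <= 1.
  rewrite u0/=; have /andP[dx0 dx1] := dx j.
  have := ge0_ler_powR (_ : 0 <= 1 - alpha) _ _ dx1.
  by rewrite powR1; apply; rewrite ?nnegrE//; lra.
have ldu i : load u i <= 1 - 3 / 4 * eps.
  have -> : load u i = (1 - d) * (A *m xstar) i 0.
    rewrite mxE mulr_sumr; apply: eq_bigr => j _.
    rewrite -powRrM divff; last by lra.
    by rewrite powRr1; [ring|case/andP: (dx j)].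
  by rewrite -[leRHS]mulr1 ler_wpM2l//; rewrite /d; lra.
have pen := penalty_low_load u1 ldu.
have Su : \sum_j u j = (1 - d) `^ (1 - alpha) * S.
  by rewrite mulr_sumr; apply: eq_bigr => j _; rewrite /u powRM//; lra.
have dS : (1 - 6 / 5 * (1 - alpha) * eps) * S <= \sum_j u j.
  rewrite Su ler_wpM2r ?optimum_ge0//.
  apply: le_trans (powR1B_ge d1 _); last by lra.
  (* As d <= 3/8, the ratio is at most (3/4) / (5/8) = 6/5 times eps. *)
  have : d / (1 - d) <= 6 / 5 * eps by rewrite ler_pdivrMr /d; [nra|lra].
  by move/(ler_wpM2l (_ : 0 <= 1 - alpha)); lra.
have uS : \sum_j u j <= S.
  apply: sum_le_optimum => // i; apply: le_trans (ldu i) _; lra.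
have S0 := optimum_ge0.
have SK : \sum_j primal K j <= S.
  by apply: sum_le_optimum => [j|i]; [exact: primal_ge0|exact: load_primal].
have SI : \sum_j primal 0 j <= S.
  by apply: sum_le_optimum => [j|i]; [exact: primal_ge0|exact: load_primal].
have f0 := objective0_le.
have fK := sum_primal_ge_objective K.
have fu : objective u <= - (1 - (1 - alpha) * eps / 48) * \sum_j u j.
  by rewrite /objective; lra.
have I0 : 0 <= \sum_j primal 0 j by apply: sumr_ge0 => j _; exact: primal_ge0.
have U0 : 0 <= \sum_j u j by exact: sumr_ge0.
have ae : (1 - alpha) * eps <= 1 / 2 by nra.
have X87 : 1 <= X0 <= 8 / 7 by lra.
have f00 : objective (primal 0) <= 0.
  apply: le_trans f0 _; rewrite mulNr oppr_le0.
  by apply: mulr_ge0; [lra|exact: I0].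
apply: (@regret_arith _ (1 - alpha) eps b' X0 (K%:R * (eta * b')) S
  (\sum_j primal 0 j) (\sum_j u j) _ (objective (primal 0)) (objective u)
  (objective (primal K))).
- by lra.
- exact: e.
- by apply/andP; split; [exact: b'0|exact: b'e].
- exact: X0b.
- exact: steps_ge.
- by apply/andP; split; [exact: I0|exact: SI].
- by apply/andP; split; [exact: U0|exact: uS].
- exact: dS.
- exact: f00.
- exact: fu.
- by rewrite lerNl; exact: fK.
- exact: SK.
apply: le_trans (regret A0 A1 Arho Acol m0 n0 rho1 al01 e12 u0 (leqnn K)) _.
(* The final divergence is nonnegative and is dropped; the initial one is bounded coordinatewise. *)
rewrite lerD2r; apply: le_trans (_ : \sum_j bregman b' (u j) X0 <= _).
  rewrite gerBl; apply: sumr_ge0 => j _; apply: bregman_ge0 => //; first lra.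
  have := (feasible_iterateP A0 A1 Arho Acol m0 n0 rho1 al01 e12 K).1 j; lra.
rewrite !mulr_sumr -big_split/=; apply: ler_sum => j _; rewrite [(X0 - 1) * _]mulrC.
apply: bregman_initial_le.
- by apply/andP; split; [exact: b'0|exact: bq].
- exact: u1.
- exact: X87.
- exact: primal_ge0.
- exact: (dual_init_primal0 A n0 rho1 al01 e12 j).
Qed.

End Quality.

(** * Size of the iteration count *)

Section IterationCount.
Context {R : realType}.
Variables (m n : nat) (rho alpha eps : R).
Hypotheses (m0 : (0 < m)%N) (n0 : (0 < n)%N) (rho1 : 1 <= rho)
  (al01 : 0 <= alpha < 1) (e12 : 0 < eps < 1 / 2).
Local Notation lam := (4 * m%:R * n%:R * rho / eps).
Local Notation b := (beta m n rho alpha eps).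
Local Notation b' := (beta' n rho alpha eps).
Local Notation q := ((1 + b) / ((1 - alpha) * b)).
Local Notation eta := ((16 * q)^-1).
Local Notation K := (num_iter m n rho alpha eps).
Local Notation l1 := (ln (n%:R * rho)).
Local Notation l2 := (ln (m%:R * n%:R * rho / eps)).
Local Notation L := (ln (n%:R * rho / (1 - eps))).
Local Notation rate := (iter_rate m n rho alpha eps).

(** Up to a factor between 512 and 2048 this is the rate with slightly larger arguments in its two
    logarithms. *)
Lemma iter_count_closed_form : 2 / (eta * b' * (1 - alpha)) =
  512 * (1 + b) * (1 + alpha) * (ln lam * L / ((1 - alpha) ^+ 3 * eps ^+ 2)).
Proof.
have [H [e [/andP[b0 _] /andP[b'0 _]]]] :=
  (al01, (e12, (beta_bounds m0 n0 rho1 al01 e12, beta'_bounds n0 rho1 al01 e12))).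
have l := ln_lam_ge m0 n0 rho1 e12; have l' := ln_nrho_ge n0 rho1 e12.
have -> : 2 / (eta * b' * (1 - alpha)) = 32 * (1 + b) / (1 - alpha) ^+ 2 * b^-1 * b'^-1.
  by move: b0 b'0; set B := b; set B' := b' => ? ?; field; lra.
rewrite (betaVE m0 n0 rho1 al01 e12).
have -> : b'^-1 = 4 * L / ((1 - alpha) * eps).
  by rewrite /beta'; move: l'; set l' := L => ?; field; lra.
by set l'' := L; set l3 := ln lam; set B := b; field; lra.
Qed.

Lemma ln_size_ge : 1 / 2 <= l2.
Proof.
have := lam_ge m0 n0 rho1 e12; set y := m%:R * n%:R * rho / eps.
have -> : lam = 4 * y by rewrite /y; ring.
have N := nrho_ge1 n0 rho1; have m1 : 1 <= m%:R :> R by rewrite ler1n.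
move=> le; apply: le_trans ln2_ge _.
have : n%:R * rho <= m%:R * (n%:R * rho) by rewrite ler_peMl//; lra.
by move=> ?; rewrite ler_ln ?posrE//; lra.
Qed.

(** The difference of the logarithms is ln 4 <= 2 <= 4 l2. *)
Lemma ln_lam_bounds : l2 <= ln lam <= 5 * l2.
Proof.
have l0 := ln_size_ge; have L0 := lam_ge_nrho m0 n0 rho1 e12.
have N := nrho_ge1 n0 rho1.
have lamE : lam = 4 * (m%:R * n%:R * rho / eps) by ring.
have y0 : 0 < m%:R * n%:R * rho / eps by move: L0; rewrite lamE; lra.
have -> : ln lam = ln 4 + l2 by rewrite lamE lnM ?posrE.
have -> : ln 4 = 2 * ln 2 :> R.
  by rewrite (_ : 4 = 2 ^+ 2) ?lnXn -?natrX// mulr_natl.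
have := @ln2_ge R; have : ln 2 <= 1 :> R.
  by have := @le_ln1Dx R 1 ltac:(lra).
by lra.
Qed.

Lemma ln_shrunk_bounds : l1 <= L <= l1 + 1.
Proof.
have N := nrho_ge1 n0 rho1; have e := e12.
rewrite ln_div ?posrE; [|lra|lra].
have := @ln_ge_sub1V R (1 - eps) ltac:(lra).
have : ln (1 - eps) <= 0 by rewrite ln_le0//; lra.
have : (1 - eps)^-1 <= 2.
  by rewrite -[2]invrK lef_pV2 ?posrE ?invr_gt0//; lra.
lra.
Qed.

Lemma iter_rate_le : rate <= K%:R.
Proof.
have [H [e /andP[b0 _]]] := (al01, (e12, beta_bounds m0 n0 rho1 al01 e12)).
have /andP[+ _] := num_iter_bounds m0 n0 rho1 al01 e12.
rewrite iter_count_closed_form; apply: le_trans.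
have d0 : 0 < (1 - alpha) ^+ 3 * eps ^+ 2.
  by rewrite mulr_gt0// exprn_gt0//; lra.
have [l20 l10] : 0 <= l2 /\ 0 <= l1.
  by split; [have := ln_size_ge; lra|rewrite ln_ge0// nrho_ge1].
have [/andP[h1 _] /andP[h2 _]] := (ln_lam_bounds, ln_shrunk_bounds).
have rx : rate <= ln lam * L / ((1 - alpha) ^+ 3 * eps ^+ 2).
  by rewrite /iter_rate ler_pM2r ?invr_gt0// [l1 * l2]mulrC; exact: ler_pM.
have rate0 : 0 <= rate.
  by apply: divr_ge0; [exact: mulr_ge0|exact: ltW].
apply: (le_trans rx); apply: ler_peMl; first exact: le_trans rx.
by move: b0; set B := b => ?; nra.
Qed.

Lemma num_iter_le r0 : 1 < r0 -> r0 <= n%:R * rho ->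
  K%:R <= 20480 * (1 + (ln r0)^-1) * rate.
Proof.
move=> r01 rn.
have [H [e /andP[b0 b1]]] := (al01, (e12, beta_bounds m0 n0 rho1 al01 e12)).
have /andP[_ +] := num_iter_bounds m0 n0 rho1 al01 e12.
rewrite iter_count_closed_form; set d := (1 - alpha) ^+ 3 * eps ^+ 2.
have d0 : 0 < d by rewrite mulr_gt0// exprn_gt0//; lra.
have d1 : d <= eps.
  rewrite /d expr2 mulrA ler_piMl//; first lra.
  have : (1 - alpha) ^+ 3 <= 1 by rewrite exprn_ile1//; lra.
  have : 0 <= (1 - alpha) ^+ 3 by rewrite exprn_ge0//; lra.
  by move: (_ ^+ 3) => y; nra.
have r00 : 0 < ln r0 by rewrite ln_gt0.
have rl : ln r0 <= l1 by rewrite ler_ln ?posrE//; lra.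
have [l20 Le] := (ln_size_ge, ln_nrho_ge n0 rho1 e12).
have [/andP[h1 h2] /andP[h3 h4]] := (ln_lam_bounds, ln_shrunk_bounds).
(* The additive 1 in L <= l1 + 1 is absorbed by l1 >= ln r0; this is where n rho must stay away from
   1. *)
have Lu : L <= (1 + (ln r0)^-1) * l1.
  have : 1 <= (ln r0)^-1 * l1 by rewrite mulrC ler_pdivlMr// mul1r.
  lra.
set x := ln lam * L / d => Ku.
(* This lower bound, from d <= eps <= L, lets the constant absorb the extra 1 of the ceiling. *)
have x1 : 1 / 2 <= x.
  rewrite /x ler_pdivlMr//; apply: le_trans (_ : 1 / 2 * L <= _).
    by rewrite ler_pM2l; lra.
  by rewrite ler_wpM2r//; lra.
have xu : x <= 5 * (1 + (ln r0)^-1) * rate.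
  rewrite /x /iter_rate -/d mulrA ler_pM2r ?invr_gt0//.
  have -> : 5 * (1 + (ln r0)^-1) * (l1 * l2) = (5 * l2) * ((1 + (ln r0)^-1) * l1).
    by ring.
  by apply: ler_pM => //; lra.
have co : 512 * (1 + b) * (1 + alpha) <= 2048.
  by move: b0 b1; set B := b => ? ?; nra.
have cx : 512 * (1 + b) * (1 + alpha) * x <= 2048 * x by rewrite ler_wpM2r//; lra.
lra.
Qed.

End IterationCount.

(** A zero column would leave its coordinate unconstrained, and raising that coordinate by 1 would
    improve the optimum. *)
Lemma optimal_col_neq0 (R : realType) m n (A : 'M[R]_(m, n)) (alpha : R) xstar :
  alpha < 1 -> fair_packing_optimal A alpha xstar ->
  forall j, exists i, A i j != 0.
Proof.
move=> al1 [[ax x0] opt] j; apply/existsP; apply: contraT => /existsPn Aj0.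
pose y := xstar + delta_mx j 0.
have yE k : y k 0 = xstar k 0 + (k == j)%:R by rewrite !mxE andbT.
have : packing_feasible A y.
  split=> [i|k]; last by rewrite yE addr_ge0.
  rewrite mulmxDr -colE mxE [X in _ + X]mxE; have /negPn/eqP-> := Aj0 i.
  by rewrite addr0.
move/opt; rewrite /fair_utility (bigD1 j)//= [leRHS](bigD1 j)//=.
rewrite [X in _ + X <= _](eq_bigr (fun k => xstar k 0 `^ (1 - alpha) / (1 - alpha))).
  have a0 : 0 < 1 - alpha by lra.
  rewrite lerD2r ler_pM2r ?invr_gt0// yE eqxx leNgt.
  by rewrite gt0_ltr_powR ?nnegrE ?addr_ge0// ltrDl.
by move=> k /negPf kj; rewrite yE kj addr0.
Qed.

(* The Theta bound: the lower constant c is absolute and holds for every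
   instance; the upper constant C is uniform over all instances for which
   n * rho is bounded away from 1 (log (n * rho) vanishes when n * rho = 1,
   whereas K does not). *)
Theorem theorem3 (R : realType) :
  exists c : R, 0 < c /\
  forall r0 : R, 1 < r0 ->
  exists C : R, 0 < C /\
  forall (m n : nat) (A : 'M[R]_(m, n)) (rho alpha eps : R),
    normalized_mx A rho ->
    0 <= alpha < 1 ->
    0 < eps < Num.min (1 / 2) (1 / (10 * (1 - alpha))) ->
    let K := num_iter m n rho alpha eps in
    let xa := x_output A rho alpha eps in
    (c * iter_rate m n rho alpha eps <= K%:R /\
     (r0 <= n%:R * rho -> K%:R <= C * iter_rate m n rho alpha eps)) /\
    (forall xstar : 'cV[R]_n, fair_packing_optimal A alpha xstar ->
       packing_feasible A xa /\
       fair_utility alpha xa - fair_utility alpha xstar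
         >= - (3 * eps * (1 - alpha) * fair_utility alpha xstar)).
Proof.
exists 1; split=> // r0 r01; exists (20480 * (1 + (ln r0)^-1)).
have r00 : 0 < (ln r0)^-1 by rewrite invr_gt0 ln_gt0.
split=> [|m n A rho alpha eps]; first by lra.
case=> A0 [[i1 [j1 A11]] A1] [[i2 [j2 Arho]] Ale] al01 /andP[e0].
rewrite lt_min => /andP[e1 _] K xa.
have m0 : (0 < m)%N by exact: leq_ltn_trans (ltn_ord i1).
have n0 : (0 < n)%N by exact: leq_ltn_trans (ltn_ord j1).
have rho1 : 1 <= rho by rewrite -A11.
have e12 : 0 < eps < 1 / 2 by rewrite e0.
split.
  by split=> [|rn]; [rewrite mul1r; exact: iter_rate_le|exact: num_iter_le].
move=> xstar opt.
have Acol : forall j, exists i, A i j != 0.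
  by apply: optimal_col_neq0 opt; case/andP: al01.
have a0 : 1 - alpha != 0 by lra.
have xaE j : xa j 0 = primal A rho alpha eps K j `^ (1 - alpha)^-1.
  by rewrite /xa /x_output mxE x_iterE.
split; first split=> [i|j].
- have := load_primal A0 A1 Ale Acol m0 n0 rho1 al01 e12 K i.
  apply: le_trans; rewrite mxE le_eqVlt; apply/orP; left; apply/eqP.
  by apply: eq_bigr => j _; rewrite xaE.
- by rewrite xaE powR_ge0.
have -> : fair_utility alpha xa = (\sum_j primal A rho alpha eps K j) / (1 - alpha).
  rewrite /fair_utility mulr_suml; apply: eq_bigr => j _.
  by rewrite xaE -powRrM mulVf// powRr1//; exact: primal_ge0.
have -> : fair_utility alpha xstar = (\sum_j xstar j 0 `^ (1 - alpha)) / (1 - alpha).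
  by rewrite /fair_utility mulr_suml.
have : (1 - 3 * eps * (1 - alpha)) * (\sum_j xstar j 0 `^ (1 - alpha)) <=
    \sum_j primal A rho alpha eps K j.
  have [n1|n1] := leqP n 1.
    by apply: primal_quality_dim1 => //; [apply/eqP; rewrite eqn_leq n1|exists i2, j2].
  exact: primal_quality.
have aV : 0 < (1 - alpha)^-1 by rewrite invr_gt0; lra.
move/(ler_wpM2r (ltW aV)).
set S := \sum_j _; set P := \sum_j _; set r := (1 - alpha)^-1.
lra.
Qed.
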